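(* Let $L=\bigoplus_{i\ge 1}L_i$ be a Nottingham algebra with second diamond $L_q$, and let $y$ be a nonzero element of $L_1$ which centralizes $L_2$. Let $x\in L_1$ be such that $x,y$ are standard generators of $L$ (types of diamonds are understood with respect to these). The following assertions hold. (a) No more than two consecutive homogeneous components of $L$ can be not centralized by $y$. (b) If $[L_{m-1}y]\neq 0$ and $[L_my]\neq 0$ (with $m-1\ge 1$), then $L_m$ is two-dimensional (a genuine diamond) and can be assigned a type, that is, $L_m$ is a diamond of type $\mu$ for some $\mu\in\mathbb F\cup\{\infty\}$. (c) If $[L_{m-2}y]=0$, $[L_{m-1}y]\neq 0$ and $[L_my]=0$ (with $m-2\ge 1$), then $L_m$ is a fake diamond of type $0$. Equivalently, $L_{m-1}$ may be viewed as a fake diamond of type $1$ (i.e. it satisfies the definition of a diamond of type $1$). (d) The difference in degree of any two consecutive (possibly fake) diamonds equals $q-1$, for an appropriate interpretation of the fake diamonds if present. Precisely: assign to each genuine diamond $L_m$ ($m\ge 1$, $\dim L_m=2$) the single admissible degree $m$, and to each fake diamond (an occurrence, for some $m$ with $m-2\ge 1$, of $[L_{m-2}y]=0$, $[L_{m-1}y]\ne 0$, $[L_my]=0$) the two admissible degrees $m-1$ (viewing $L_{m-1}$ as a diamond of type $1$) and $m$ (viewing $L_m$ as a diamond of type $0$). Then for any two consecutive diamonds, genuine or fake, in the natural order by degree, there are an admissible degree $d$ of the earlier one and an admissible degree $d'$ of the later one with $d'-d=q-1$. (The admissible degree used for a given fake diamond may be different when it is compared with the previous diamond and when it is compared with the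 next one.)
   Context: Lie products are written without commas and are left-normed: $[abc]=[[ab]c]$, and $[ab^i]=[ab\cdots b]$ with $b$ occurring $i$ times. For a subspace $V$ and element $z$, $[Vz]=\{[vz]:v\in V\}$; ''$z$ centralizes $V$'' means $[Vz]=0$. A thin Lie algebra over a field $\mathbb F$ is an infinite-dimensional graded Lie algebra $L=\bigoplus_{i\ge 1}L_i$ over $\mathbb F$ with $\dim L_1=2$, satisfying the covering property: $[zL_1]=L_{i+1}$ for every $i$ and every nonzero $z\in L_i$; it is also required that at least one component $L_i$ with $i>1$ has dimension two. (Components then have dimension $1$ or $2$.) Two-dimensional components are called (genuine) diamonds; $L_1$ is the first diamond, and the two-dimensional component $L_k$ with $k>1$ smallest is the second diamond. A Nottingham algebra is a thin Lie algebra over a field $\mathbb F$ of characteristic $p>3$ whose second diamond is $L_q$, where $q>5$ is a power of $p$. All components mentioned have index at least $1$. Standard generators: in a Nottingham algebra there is a nonzero $y\in L_1$, unique up to scalars, with $[L_2y]=0$, and one can choose $x\in L_1$ such that $x,y$ is a basis of $L_1$ and, setting $v_1=[yx^{q-2}]$ (which spans $L_{q-1}$), $[v_1xx]=0=[v_1yy]$ and $[v_1yx]=-2[v_1xy]$. Such $x,y$ are called standard generators; each is determined up to a scalar multiple, and the definitions below do not depend on the choice. Types: it is known that no two consecutive components are both two-dimensional. Let $m>1$ with $\dim L_m=2$ and let $w$ span $L_{m-1}$. $L_m$ is a diamond of finite type $\mu\in\mathbb F$ if $[wxx]=0=[wyy]$ and $\mu[wyx]=(1-\mu)[wxy]$;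 it is a diamond of infinite type ($\mu=\infty$) if $[wxx]=0=[wyy]$ and $[wyx]=-[wxy]$. (Types $0,1$ cannot occur for two-dimensional components.) No type is assigned to $L_1$. Fake diamonds: suppose $m>1$ and $L_{m-1}$ is one-dimensional, spanned by $w$. $L_m$ is a (fake) diamond of type $1$ if $[wxx]=0$ and $[wy]=0$; it is a (fake) diamond of type $0$ if $[wx]=0$ and $[wyy]=0$. Fake diamonds are one-dimensional components. Whenever $L_m$ satisfies the definition of a diamond of type $1$, $L_{m+1}$ satisfies the definition of a diamond of type $0$; these count as one and the same fake diamond, regarded either as $L_m$ of type $1$ or as $L_{m+1}$ of type $0$, but not both at once. *)

(* Defs.v *)
From HB Require Import structures.
From mathcomp Require Import all_boot all_order all_algebra.

Set Implicit Arguments.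
Unset Strict Implicit.
Unset Printing Implicit Defensive.

Import GRing.Theory.
Local Open Scope ring_scope.

(* gcomp i is the component L_i, meaningful only for 0 < i; the value of gcomp 0
   is never used.  The last two axioms say that the carrier is the direct sum
   of the gcomp i with 0 < i. *)
Record gradedLie (F : fieldType) := GradedLie {
  carrier :> lmodType F;
  bracket : carrier -> carrier -> carrier;
  gcomp : nat -> {pred carrier};
  bracket_linearl : forall b, linear (bracket^~ b);
  bracket_linearr : forall a, linear (bracket a);
  bracket_alt : forall a, bracket a a = 0;
  bracket_jacobi : forall a b c,
    bracket (bracket a b) c + bracket (bracket b c) a
      + bracket (bracket c a) b = 0;
  gcomp_submod : forall i, (0 < i)%N -> submod_closed (gcomp i);
  gcomp_bracket : forall i j a b, (0 < i)%N -> (0 < j)%N ->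
    a \in gcomp i -> b \in gcomp j -> bracket a b \in gcomp (i + j)%N;
  gcomp_generate : forall v : carrier, exists (n : nat) (u : nat -> carrier),
    (forall i, (0 < i)%N -> u i \in gcomp i) /\ v = \sum_(1 <= i < n) u i;
  gcomp_direct : forall (n : nat) (u : nat -> carrier),
    (forall i, (0 < i)%N -> u i \in gcomp i) -> \sum_(1 <= i < n) u i = 0 ->
    forall i, (0 < i < n)%N -> u i = 0
}.

Arguments bracket {F g}.
Arguments gcomp {F} g i%_N.

(* Left associative, so that a ** b ** c is the left-normed product [abc]. *)
Notation "a ** b" := (bracket a b) (at level 40, left associativity).

Section Definitions.

Variables (F : fieldType) (L : gradedLie F).
Implicit Types (x y z w : L) (V : {pred L}).

Definition spans V n (e : n.-tuple L) : Prop :=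
  forall v, v \in V <-> exists c : 'I_n -> F, v = \sum_i c i *: tnth e i.

Definition lin_indep n (e : n.-tuple L) : Prop :=
  forall c : 'I_n -> F, \sum_i c i *: tnth e i = 0 -> forall i, c i = 0.

Definition is_basis V n (e : n.-tuple L) : Prop := spans V e /\ lin_indep e.

Definition has_dim V n : Prop := exists e : n.-tuple L, is_basis V e.

Definition infinite_dim : Prop :=
  ~ exists n (e : n.-tuple L), spans (predT : {pred L}) e.

Definition centralizes z V : Prop := forall v, v \in V -> v ** z = 0.

(* The covering property is vacuous at a zero component, so it does not by
   itself exclude zero components followed by nonzero ones; that every
   component is nonzero is therefore explicit.  With it, the covering property
   makes L generated by gcomp 1 and every component of dimension 1 or 2. *)
Definition thin : Prop :=
  [/\ infinite_dim,
      has_dim (gcomp L 1) 2,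
      forall i, (0 < i)%N -> exists2 z, z \in gcomp L i & z != 0,
      forall i z, (0 < i)%N -> z \in gcomp L i -> z != 0 ->
        forall u, u \in gcomp L i.+1 <->
          exists2 a, a \in gcomp L 1 & u = z ** a
    & exists2 i, (1 < i)%N & has_dim (gcomp L i) 2].

Definition second_diamond k : Prop :=
  [/\ (1 < k)%N, has_dim (gcomp L k) 2
    & forall i, (1 < i < k)%N -> ~ has_dim (gcomp L i) 2].

Definition nottingham q : Prop :=
  [/\ thin,
      exists2 p, p \in [pchar F] & (3 < p)%N /\ exists n, q = (p ^ n)%N,
      (5 < q)%N
    & second_diamond q].

Definition standard_generators q x y : Prop :=
  let v1 := iter (q - 2) (fun u => u ** x) y in
  [/\ is_basis (gcomp L 1) [tuple x; y],
      centralizes y (gcomp L 2),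
      is_basis (gcomp L (q - 1)) [tuple v1],
      v1 ** x ** x = 0 /\ v1 ** y ** y = 0
    & v1 ** y ** x = - (v1 ** x ** y *+ 2)].

(* The type None is the infinite one.  In this and the next two definitions
   w is a basis of the preceding component; the conditions on w are invariant
   under scaling. *)
Definition diamond_of_type x y m (mu : option F) : Prop :=
  [/\ (1 < m)%N, has_dim (gcomp L m) 2
    & exists w, [/\ is_basis (gcomp L m.-1) [tuple w],
        w ** x ** x = 0, w ** y ** y = 0
      & match mu with
        | Some a => a *: (w ** y ** x) = (1 - a) *: (w ** x ** y)
        | None => w ** y ** x = - (w ** x ** y)
        end]].

Definition fake_diamond_of_type1 x y m : Prop :=
  (1 < m)%N /\ exists w, [/\ is_basis (gcomp L m.-1) [tuple w],
    w ** x ** x = 0 & w ** y = 0].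

Definition fake_diamond_of_type0 x y m : Prop :=
  (1 < m)%N /\ exists w, [/\ is_basis (gcomp L m.-1) [tuple w],
    w ** x = 0 & w ** y ** y = 0].

End Definitions.

(* Fake m is the fake diamond which is gcomp m as a diamond of type 0 and
   gcomp m.-1 as a diamond of type 1. *)
Inductive diamond := Genuine of nat | Fake of nat.

Definition is_diamond (F : fieldType) (L : gradedLie F) (y : L)
    (D : diamond) : Prop :=
  match D with
  | Genuine m => (0 < m)%N /\ has_dim (gcomp L m) 2
  | Fake m => [/\ (2 < m)%N, centralizes y (gcomp L m.-2),
      ~ centralizes y (gcomp L m.-1) & centralizes y (gcomp L m)]
  end.

Definition admissible_degree (D : diamond) (d : nat) : Prop :=
  match D with
  | Genuine m => d = m
  | Fake m => d = m.-1 \/ d = m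
  end.

(* The order by degree, required to hold for every choice of admissible
   degrees. *)
Definition earlier (D D' : diamond) : Prop :=
  forall d d', admissible_degree D d -> admissible_degree D' d' -> (d < d')%N.

Definition consecutive_diamonds (F : fieldType) (L : gradedLie F) (y : L)
    (D D' : diamond) : Prop :=
  [/\ is_diamond y D, is_diamond y D', earlier D D'
    & forall E, is_diamond y E -> ~ (earlier D E /\ earlier E D')].

(* Main.v *)
(* Put u_j = [y x^j]. A chain of polynomial identities for the structure
   constants [u_j y] = c_j u_(j+1) shows c_j = 0, so that ad u_j commutes with
   ad y for j <= q-3; moreover (ad x)^q, being a derivation which kills x and
   y, is zero. Every (possibly fake) diamond of degree e yields elements w in
   L_(e-1) and z = [w x y] in L_(e+1) with [w x x] = [w y y] = 0 and
   [w y x] = al z; al = 0 is the fake type 1. Let t be least with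
   [z x^t y] <> 0. Expanding [w', u_j y] = [w' y u_j] for w' in the chain
   ending at w gives congruences between binomial coefficients modulo p which
   force t >= q-3, apart from t = q-5 and al = -2 (type -1); that case is
   excluded by brackets with [u_(q-1) y] x^k. Since [z x^q] = 0, t < q. As
   t >= q-3, the commutation relations at the end v = [z x^t] of the chain
   give [v y y] = [v y x y] = [v x y y] = 0, whence either [v x] = 0 (fake) or
   v precedes a genuine diamond with a type. *)

(* In terms of [al] the type is 1/(1+al): the values 0, -1, -2 stand for the types 1, infinity, -1,
   the last being that of the second diamond. Type 0 has no [al], so a fake diamond is always
   entered as type 1. The exceptional case comes from the range of the relations: [y x^j] is known
   to commute with y only for j < q-2, so an element c steps before [w] is usable only for c <=
   q-4-t. At t = q-5 only c = 1 is left, which repeats 2 al = t+1. The further information sits in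
   [om] = [y x^(q-1) y], whose brackets are computable because the signed binomials of row q-1 all
   equal 1 modulo p. *)
Require Import Defs.
From mathcomp Require Import all_boot all_order all_algebra.
From mathcomp Require Import zify ring.

Set Implicit Arguments.
Unset Strict Implicit.
Unset Printing Implicit Defensive.

Import GRing.Theory.

(* [lia] preprocesses every hypothesis, which is slow among many vector
   equations. *)
Ltac nlia :=
  repeat match goal with
  | H : forall _, _ |- _ => clear H
  | H : @eq ?T _ _ |- _ =>
      lazymatch T with nat => fail | bool => fail | _ => clear H end
  | H : is_true (in_mem _ _) |- _ => clear H
  | H : is_true (~~ @eq_op ?T _ _) |- _ =>
      tryif unify (Equality.sort T) nat then fail else clear H
  end; lia.

(** * Bilinearity and the Jacobi identity in derivation form *)

Section Brackets.

Local Open Scope ring_scope.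

Variables (F : fieldType) (L : gradedLie F).
Implicit Types a b c : L.

Lemma brZDl k a b c : (k *: a + b) ** c = k *: (a ** c) + b ** c.
Proof. exact: bracket_linearl. Qed.

Lemma brZDr k a b c : a ** (k *: b + c) = k *: (a ** b) + a ** c.
Proof. exact: bracket_linearr. Qed.

Lemma br0l a : 0 ** a = 0.
Proof. by have := brZDl (-1) 0 0 a; rewrite scaler0 add0r scaleN1r addNr. Qed.

Lemma br0r a : a ** 0 = 0.
Proof. by have := brZDr (-1) a 0 0; rewrite scaler0 add0r scaleN1r addNr. Qed.

Lemma brZl k a b : (k *: a) ** b = k *: (a ** b).
Proof. by have := brZDl k a 0 b; rewrite br0l !addr0. Qed.

Lemma brZr k a b : a ** (k *: b) = k *: (a ** b).
Proof. by have := brZDr k a b 0; rewrite br0r !addr0. Qed.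

Lemma brDl a b c : (a + b) ** c = a ** c + b ** c.
Proof. by have := brZDl 1 a b c; rewrite !scale1r. Qed.

Lemma brDr a b c : a ** (b + c) = a ** b + a ** c.
Proof. by have := brZDr 1 a b c; rewrite !scale1r. Qed.

Lemma brNl a b : (- a) ** b = - (a ** b).
Proof. by rewrite -scaleN1r brZl scaleN1r. Qed.

Lemma br_sumr I r (P : pred I) (f : I -> L) b :
  (\sum_(i <- r | P i) f i) ** b = \sum_(i <- r | P i) (f i ** b).
Proof.
by elim/big_rec2: _ => [|i u v _ <-]; rewrite ?br0l ?brDl.
Qed.

Lemma brC a b : a ** b = - (b ** a).
Proof.
have := bracket_alt (a + b).
rewrite brDl !brDr !bracket_alt add0r addr0 => /eqP.
by rewrite addr_eq0 => /eqP.
Qed.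

Lemma brA a b c : a ** (b ** c) = a ** b ** c - a ** c ** b.
Proof.
have := bracket_jacobi a b c; rewrite (brC (b ** c)) (brC c a) brNl.
by rewrite addrAC => /eqP; rewrite subr_eq0 => /eqP.
Qed.

End Brackets.

(** * Leibniz expansion of [a, b x^j] *)

Section Powers.

Local Open Scope ring_scope.

Variables (F : fieldType) (L : gradedLie F) (x : L).
Implicit Types a b : L.

Definition adx k a : L := iter k (fun u => u ** x) a.

Lemma adx0 a : adx 0 a = a. Proof. by []. Qed.
Lemma adxS k a : adx k.+1 a = adx k a ** x. Proof. by []. Qed.
Lemma adxSr k a : adx k.+1 a = adx k (a ** x). Proof. exact: iterSr. Qed.
Lemma adxD k l a : adx (k + l) a = adx k (adx l a). Proof. exact: iterD. Qed.
Lemma adxZ k (s : F) a : adx k (s *: a) = s *: adx k a.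
Proof. by elim: k => //= k ->; rewrite brZl. Qed.
Lemma adxDr k a b : adx k (a + b) = adx k a + adx k b.
Proof. by elim: k => //= k ->; rewrite brDl. Qed.
Lemma adx00 k : adx k 0 = 0.
Proof. by elim: k => //= k ->; rewrite br0l. Qed.
Lemma adx_eq0 k l a : (k <= l)%N -> adx k a = 0 -> adx l a = 0.
Proof. by move=> /subnK <- E; rewrite adxD E adx00. Qed.

(* [sbin j k] is the signed binomial of the Leibniz expansion of [a, [b x^j]];
   it vanishes for k > j, so sums may run past their natural end. *)
Definition sbin j k : F := (-1) ^+ k * 'C(j, k)%:R.

Lemma sbin0 j : sbin j 0 = 1.
Proof. by rewrite /sbin bin0 mulr1. Qed.

Lemma sbin_gt j k : (j < k)%N -> sbin j k = 0.
Proof. by move=> jk; rewrite /sbin bin_small ?mulr0. Qed.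

Lemma sbinS j k : sbin j.+1 k.+1 = sbin j k.+1 - sbin j k.
Proof. by rewrite /sbin binS natrD mulrDr exprS; congr (_ + _); ring. Qed.

Lemma sbinn j : sbin j j = (-1) ^+ j.
Proof. by rewrite /sbin binn mulr1. Qed.

Lemma leibniz a b j n : (j < n)%N ->
  a ** adx j b = \sum_(k < n) sbin j k *: adx (j - k) (adx k a ** b).
Proof.
elim: j a n => [|j IHj] a n jn.
  case: n jn => // n _; rewrite big_ord_recl /= big1 ?addr0 => [|i _].
    by rewrite sbin0 scale1r.
  by rewrite sbin_gt ?scale0r.
rewrite adxS brA (IHj a n (ltnW jn)); case: n jn => // n jn.
rewrite (IHj (a ** x) n jn) !big_ord_recl /= !sbin0 !scale1r !subn0 brDl.
rewrite -addrA -adxS; congr (_ + _); rewrite br_sumr -sumrB.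
apply: eq_bigr => i _; rewrite /bump /= add1n sbinS scalerBl -adxSr subSS.
congr (_ - _); rewrite brZl.
have [ij|ij] := ltnP i j; last by rewrite sbin_gt ?scale0r.
by rewrite -adxS -subSn // subSS.
Qed.

Lemma leibniz3 a b j n :
  (forall k, (k < n)%N -> adx k a ** b = 0) ->
  (forall k, (n + 3 <= k <= j)%N -> adx k a ** b = 0) ->
  a ** adx j b = sbin j n *: adx (j - n) (adx n a ** b)
    + sbin j n.+1 *: adx (j - n.+1) (adx n.+1 a ** b)
    + sbin j n.+2 *: adx (j - n.+2) (adx n.+2 a ** b).
Proof.
move=> lo hi; rewrite (@leibniz a b j (n + (3 + j))); last by lia.
rewrite big_split_ord /= big1 ?add0r => [|i _]; last first.
  by rewrite lo // adx00 scaler0.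
rewrite big_split_ord /= [X in _ + X]big1 ?addr0 => [|i _]; last first.
  have [ij|ij] := leqP (n + (3 + i)) j; last by rewrite sbin_gt ?scale0r.
  by rewrite hi ?adx00 ?scaler0 //; lia.
by rewrite !big_ord_recl big_ord0 /= addr0 addrA /bump /= !addn0 !addn1 addn2.
Qed.

Lemma leibniz2 a b j n :
  (forall k, (k < n)%N -> adx k a ** b = 0) ->
  (forall k, (n + 2 <= k <= j)%N -> adx k a ** b = 0) ->
  a ** adx j b = sbin j n *: adx (j - n) (adx n a ** b)
    + sbin j n.+1 *: adx (j - n.+1) (adx n.+1 a ** b).
Proof.
move=> lo hi; rewrite (leibniz3 lo) => [|k kj]; last by apply: hi; lia.
have [jn|jn] := ltnP j n.+2; first by rewrite (sbin_gt jn) scale0r addr0.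
by rewrite (hi n.+2) ?adx00 ?scaler0 ?addr0 //; lia.
Qed.

Lemma leibniz1 a b j n :
  (forall k, (k < n)%N -> adx k a ** b = 0) ->
  (forall k, (n < k <= j)%N -> adx k a ** b = 0) ->
  a ** adx j b = sbin j n *: adx (j - n) (adx n a ** b).
Proof.
move=> lo hi; rewrite (leibniz2 lo) => [|k kj]; last by apply: hi; lia.
have [jn|jn] := ltnP j n.+1; first by rewrite (sbin_gt jn) scale0r addr0.
by rewrite (hi n.+1) ?adx00 ?scaler0 ?addr0 //; lia.
Qed.

End Powers.

(** * Binomial coefficients modulo p, after Lucas *)

Section Characteristic.

Local Open Scope ring_scope.

Variables (F : fieldType) (p : nat).
Hypothesis (pF : p \in [pchar F]).

Let p_pr : prime p := pcharf_prime pF.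

Lemma bin_ppow h k : (0 < k < p ^ h)%N -> 'C(p ^ h, k)%:R = 0 :> F.
Proof.
case: k => // k /andP[_ kp]; apply/eqP; rewrite -(dvdn_pcharf pF).
apply/negPn/negP => ndvd; have := mul_bin_diag (p ^ h) k.
move/(congr1 (dvdn (p ^ h))); rewrite dvdn_mulr // Gauss_dvdl; last first.
  by rewrite coprimeXl // prime_coprime.
by move/esym/dvdn_leq => /(_ isT); rewrite leqNgt kp.
Qed.

(** Coefficients of (1+X)^(p^h+e) = (1+X^(p^h)) (1+X)^e. *)
Lemma bin_addppow h e k :
  'C(p ^ h + e, k)%:R
    = 'C(e, k)%:R + (if (p ^ h <= k)%N then 'C(e, k - p ^ h)%:R else 0) :> F.
Proof.
have q0 : (0 < p ^ h)%N by rewrite expn_gt0 prime_gt0.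
elim: e k => [|e IHe] [|k].
- by rewrite !bin0 leqNgt q0 addr0.
- rewrite addn0 bin0n add0r; case: ltngtP => [pk|kp|->].
  + by rewrite bin0n subn_eq0 leqNgt pk bin_small.
  + by rewrite bin_ppow.
  + by rewrite subnn !binn.
- by rewrite !bin0 leqNgt q0 addr0.
rewrite addnS !binS !natrD !IHe; case: (ltngtP (p ^ h) k.+1) => pk.
- by rewrite -ltnS pk subSn // binS natrD; ring.
- by rewrite leqNgt (ltnW pk) /=; ring.
by rewrite pk subnn !bin0 ltnn; ring.
Qed.

Lemma bin_mulppow_lt h r e k : (k < p ^ h)%N ->
  'C(r * p ^ h + e, k)%:R = 'C(e, k)%:R :> F.
Proof.
move=> kp; elim: r => [|r IHr]; first by rewrite mul0n.
by rewrite mulSn -addnA bin_addppow leqNgt kp addr0.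
Qed.

Lemma bin_mulppow_eq h r e : (e < p ^ h)%N ->
  'C(r * p ^ h + e, p ^ h)%:R = r%:R :> F.
Proof.
move=> ep; elim: r => [|r IHr]; first by rewrite mul0n bin_small.
by rewrite mulSn -addnA bin_addppow leqnn subnn bin0 IHr natr1.
Qed.

(** Modulo p, (1-X)^(p^h-1) = (1-X^(p^h))/(1-X) = 1 + X + ... + X^(p^h-1). *)
Lemma sbin_ppow_pred h k : (k < p ^ h)%N -> sbin F (p ^ h).-1 k = 1.
Proof.
have q0 : (0 < p ^ h)%N by rewrite expn_gt0 prime_gt0.
elim: k => [|k IHk] kp; first exact: sbin0.
have := sbinS F (p ^ h).-1 k; rewrite prednK // {1}/sbin bin_ppow //.
by rewrite mulr0 (IHk (ltnW kp)) => /esym/eqP; rewrite subr_eq0 => /eqP.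
Qed.

End Characteristic.

(** * The derivation (ad x)^(p^n) *)

Section Nilpotency.

Local Open Scope ring_scope.

Variables (F : fieldType) (p n : nat) (L : gradedLie F) (x : L).
Hypothesis (pF : p \in [pchar F]).

Lemma adx_ppow_der (a b : L) :
  a ** adx x (p ^ n) b
    = adx x (p ^ n) (a ** b) + sbin F (p ^ n) (p ^ n) *: (adx x (p ^ n) a ** b).
Proof.
rewrite (@leibniz _ _ _ _ _ _ (p ^ n).+1) // big_ord_recl.
have q0 : (0 < p ^ n)%N by rewrite expn_gt0 (prime_gt0 (pcharf_prime pF)).
rewrite sbin0 scale1r subn0 /=; congr (_ + _).
have [m mq] : exists m, (p ^ n = m.+1)%N by exists (p ^ n).-1; rewrite prednK.
move: (p ^ n)%N mq (@bin_ppow _ _ pF n) => _ -> binq.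
rewrite big_ord_recr /= big1 ?add0r => [|i _].
  by rewrite /bump /= add1n subnn.
by rewrite /bump /= add1n /sbin binq ?mulr0 ?scale0r //= ltnS.
Qed.

End Nilpotency.

(** * Chains of elements killed by b, and brackets at their ends *)

Section Chains.

Local Open Scope ring_scope.

Variables (F : fieldType) (L : gradedLie F) (x y : L).
Implicit Types a b v w z : L.
Local Notation X := (adx x).

Lemma scale_inj v (s t : F) : v != 0 -> s *: v = t *: v -> s = t.
Proof.
move=> v0 /eqP; rewrite -subr_eq0 -scalerBl scaler_eq0 (negPf v0) orbF.
by rewrite subr_eq0 => /eqP.
Qed.

Lemma scale_zero v (s : F) : v != 0 -> s *: v = 0 -> s = 0.
Proof. by move=> v0 /eqP; rewrite scaler_eq0 (negPf v0) orbF => /eqP. Qed.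

Definition chain a b m := forall k, (k < m)%N -> X k a ** b = 0.

Lemma chainW a b m l : (l <= m)%N -> chain a b m -> chain a b l.
Proof. by move=> lm ch k kl; apply: ch; apply: leq_trans lm. Qed.

Lemma chain_adx a b m l : chain a b (m + l) -> chain (X l a) b m.
Proof. by move=> ch k km; rewrite -adxD; apply: ch; rewrite ltn_add2r. Qed.

Lemma bin2_sub m : 'C(m.+2, m) = 'C(m.+2, 2).
Proof. by rewrite -[RHS]bin_sub // subn2. Qed.

Section Tail.

Variables (a b : L) (m : nat).
Hypothesis ch : chain a b m.
Local Notation v := (X m a).

Lemma tail0 : a ** X m b = (-1) ^+ m *: (v ** b).
Proof.
rewrite (@leibniz1 _ _ _ _ _ _ m) // => [|k]; last by lia.
by rewrite sbinn subnn.
Qed.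

Lemma tail1 :
  a ** X m.+1 b = (-1) ^+ m *: (m.+1%:R *: (v ** b ** x) - v ** x ** b).
Proof.
rewrite (@leibniz2 _ _ _ _ _ _ m) // => [|k]; last by lia.
rewrite subnn subSnn sbinn /sbin binSn.
by rewrite scalerBr scalerA exprS mulN1r scaleNr.
Qed.

Lemma tail2 :
  a ** X m.+2 b = (-1) ^+ m *:
    ('C(m.+2, 2)%:R *: (v ** b ** x ** x) - m.+2%:R *: (v ** x ** b ** x)
      + v ** x ** x ** b).
Proof.
rewrite (@leibniz3 _ _ _ _ _ _ m) // => [|k]; last by lia.
rewrite subnn subSnn subSn // subSnn sbinn /sbin bin2_sub binSn.
by rewrite scalerDr scalerBr !scalerA !exprS mulrA mulrNN mul1r mulN1r mulNr
  scaleNr mul1r.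
Qed.

End Tail.

End Chains.

(** * Consequences of y commuting with [y x^j] *)

Section Relations.

Local Open Scope ring_scope.

Variables (F : fieldType) (L : gradedLie F) (x y : L) (p n q : nat).
Implicit Types a b v w z : L.
Local Notation X := (adx x).
Local Notation chain := (chain x).

Hypothesis pF : p \in [pchar F].
Hypothesis p3 : (3 < p)%N.
Hypothesis qE : q = (p ^ n)%N.
Hypothesis q5 : (5 < q)%N.
Hypothesis uy : forall j, (j < q - 2)%N -> X j y ** y = 0.
Hypothesis cov0 : forall i a, (0 < i)%N -> a \in gcomp L i ->
  a ** x = 0 -> a ** y = 0 -> a = 0.
Hypothesis cov : forall i a u, (0 < i)%N -> a \in gcomp L i -> a != 0 ->
  u \in gcomp L i.+1 -> exists s t : F, u = s *: (a ** x) + t *: (a ** y).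
Hypothesis y1 : y \in gcomp L 1.
Hypothesis memx : forall i a, (0 < i)%N -> a \in gcomp L i -> a ** x \in gcomp L i.+1.
Hypothesis memy : forall i a, (0 < i)%N -> a \in gcomp L i -> a ** y \in gcomp L i.+1.
Hypothesis adxq : forall i a, (0 < i)%N -> a \in gcomp L i -> X q a = 0.

Lemma p_odd : odd p.
Proof. by have := pcharf_prime pF; case: (even_prime (pcharf_prime pF)) p3 => [->|]. Qed.

Lemma q_odd : odd q.
Proof. by rewrite qE oddX p_odd orbT. Qed.

Lemma natF_neq0 m : (0 < m < p)%N -> m%:R != 0 :> F.
Proof. by move=> mp; rewrite -(dvdn_pcharf pF) gtnNdvd //; nlia. Qed.

Lemma two_neq0 : 2%:R != 0 :> F. Proof. by apply: natF_neq0; nlia. Qed.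
Lemma three_neq0 : 3%:R != 0 :> F. Proof. by apply: natF_neq0; nlia. Qed.

Lemma four_neq0 : 4%:R != 0 :> F.
Proof. by rewrite (natrM _ 2 2) mulf_neq0 ?two_neq0. Qed.

Lemma qF : q%:R = 0 :> F.
Proof.
rewrite qE natrX (pcharf0 pF); case: n qE => [|k _]; last by rewrite expr0n.
by rewrite expn0 => q1; move: q5; rewrite q1.
Qed.

Lemma q7 : (7 <= q)%N.
Proof.
suff /eqP : q != 6 by nlia.
by apply/eqP => q6; have := q_odd; rewrite q6.
Qed.

Lemma y_adx a j : (j < q - 2)%N -> a ** X j y ** y = a ** y ** X j y.
Proof.
by move=> /uy E; apply/eqP; rewrite -subr_eq0 -brA E br0r.
Qed.

(* Each relation expresses that [X j y] commutes with [y], applied to an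
   element [a] from which a chain centralized by [y] leads to [v]. *)
Section EndOfChain.

Variables (a : L) (m : nat).
Hypothesis m0 : (0 < m)%N.
Hypothesis ch : chain a y m.
Local Notation v := (X m a).

Let ay : a ** y = 0. Proof. exact: (ch m0). Qed.

Lemma end_rel0 : (m < q - 2)%N -> v ** y ** y = 0.
Proof.
move/(@y_adx a); rewrite ay br0l (tail0 ch) brZl => /eqP.
by rewrite scaler_eq0 signr_eq0 => /eqP.
Qed.

Lemma end_rel1 : (m.+1 < q - 2)%N ->
  m.+1%:R *: (v ** y ** x ** y) = v ** x ** y ** y.
Proof.
move/(@y_adx a); rewrite ay br0l (tail1 ch) brZl => /eqP.
rewrite scaler_eq0 signr_eq0 /= brDl brNl brZl subr_eq0 => /eqP.
by [].
Qed.

Lemma end_rel2 : (m.+2 < q - 2)%N ->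
  'C(m.+2, 2)%:R *: (v ** y ** x ** x ** y) - m.+2%:R *: (v ** x ** y ** x ** y)
    + v ** x ** x ** y ** y = 0.
Proof.
move/(@y_adx a); rewrite ay br0l (tail2 ch) brZl => /eqP.
by rewrite scaler_eq0 signr_eq0 /= !brDl brNl !brZl => /eqP.
Qed.

End EndOfChain.

(** Starting the chain one and two steps before [v] makes [v x y y] both 2 and 3 times [v y x y]. *)
Lemma end_chain a m v : chain a y m -> v = X m a -> (2 <= m)%N ->
  [/\ v ** y ** y = 0, v ** y ** x ** y = 0 & v ** x ** y ** y = 0].
Proof.
have := q7 => ? ch -> m2.
have back k : (k <= m)%N -> X m a = X k (X (m - k) a) by move=> ?; rewrite -adxD subnKC.
have chb k : (k <= m)%N -> chain (X (m - k) a) y k.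
  by move=> km; apply: chain_adx; rewrite subnKC.
have E0 := @end_rel0 _ 1 isT (chb 1%N _).
have E1 := @end_rel1 _ 1 isT (chb 1%N _).
have E2 := @end_rel1 _ 2 isT (chb 2%N _).
rewrite -!back in E0 E1 E2; try nlia.
have {}E0 : X m a ** y ** y = 0 by apply: E0; nlia.
have {}E1 : 2%:R *: (X m a ** y ** x ** y) = X m a ** x ** y ** y by apply: E1; nlia.
have {}E2 : 3%:R *: (X m a ** y ** x ** y) = X m a ** x ** y ** y by apply: E2; nlia.
have E : X m a ** y ** x ** y = 0.
  have : (3%:R - 2%:R) *: (X m a ** y ** x ** y) = 0 by rewrite scalerBl E1 E2 subrr.
  by rewrite -natrB //= scale1r.
by split=> //; rewrite -E1 E scaler0.
Qed.

(** * Brackets of the neighbourhood of a diamond with [y x^N] *)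

Section Datum.

(* A diamond with the element [w] before it and [z] after it; [al] encodes
   its type, [al = 0] being the fake type 1. *)
Variables (w g : L) (K : nat) (al : F).
Local Notation z := (w ** x ** y).
Hypothesis wxx : w ** x ** x = 0.
Hypothesis wyy : w ** y ** y = 0.
Hypothesis wyx : w ** y ** x = al *: z.
Hypothesis gw : X K g = w.
Hypothesis gch : chain g y K.

(** Only the terms at [w] and [w ** x] survive: y kills what comes before, and [w x x] = 0 ends the
    expansion. *)
Lemma back_bracket c N : (c <= K)%N -> (c < N)%N ->
  X (K - c) g ** X N y = (sbin F N c * al + sbin F N c.+1) *: X (N - c.+1) z.
Proof.
move=> cK cN; have wc : X c (X (K - c) g) = w by rewrite -adxD subnKC.
rewrite (@leibniz2 _ _ _ _ _ _ c) => [|k kc|k /andP[ck kN]].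
- rewrite adxS wc scalerDl -(subnSK cN) adxSr wyx adxZ scalerA //.
- by rewrite -adxD gch //; nlia.
have -> : k = (k - c.+2 + 2 + c)%N by nlia.
by rewrite adxD adxD wc /= wxx adx00 br0l.
Qed.

Lemma back_bracket0 N : (0 < N)%N -> w ** X N y = (al - N%:R) *: X N.-1 z.
Proof.
move=> N0; have := @back_bracket 0 N isT N0; rewrite subn0 gw => ->.
by rewrite sbin0 mul1r /sbin bin1 expr1 mulN1r subn1.
Qed.

Lemma wx_bracket N : w ** x ** X N y = X N z.
Proof.
rewrite (@leibniz1 _ _ _ _ _ _ 0) => [|k|[|k] // _]; rewrite ?sbin0 ?scale1r ?subn0 //.
by rewrite adxSr wxx adx00 br0l.
Qed.

Lemma wy_chain t : chain z y t -> chain (w ** y) y t.+1.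
Proof.
move=> ch [|k] kt; first exact: wyy.
by rewrite adxSr wyx adxZ brZl ch ?scaler0.
Qed.

Lemma adx_wy k : X k.+1 (w ** y) = al *: X k z.
Proof. by rewrite adxSr wyx adxZ. Qed.

(** * Congruences bounding the length of a chain from below *)

Section LowerBound.

Variables (i t : nat).
Hypothesis i0 : (0 < i)%N.
Hypothesis vyi : X t z ** y \in gcomp L i.
Hypothesis zch : chain z y t.
Hypothesis vy : X t z ** y != 0.
Hypothesis Kq : (q - 4 - t <= K)%N.
Hypothesis tq : (t <= q - 4)%N.
Local Notation v := (X t z).

Lemma bin2F m : 2%:R * 'C(m.+1, 2)%:R = m.+1%:R * m%:R :> F.
Proof. by rewrite -!natrM -(mul_bin_diag m.+1 1) bin1. Qed.

(** [y_adx] at [w ** x] with j = t reads [v y] = (-1)^t [v y]. *)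
Lemma gap_even : ~~ odd t.
Proof.
have := @y_adx (w ** x) t; rewrite wx_bracket (tail0 zch) => /(_ ltac:(nlia)).
case: (odd t) (signr_odd F t) => // <-.
rewrite expr1 scaleN1r => /eqP; rewrite -addr_eq0 -mulr2n -scaler_nat.
by rewrite scaler_eq0 (negPf vy) orbF (negPf two_neq0).
Qed.

(** [y_adx] at [w] with j = t+1 reads (al - (t+1)) [v y] = -al [v y]; the sign on the right uses
    that t is even. *)
Lemma gap_type : 2%:R * al = t.+1%:R.
Proof.
have := @y_adx w t.+1; rewrite back_bracket0 // (tail0 (wy_chain zch)).
rewrite adx_wy !brZl scalerA => /(_ ltac:(nlia)) /(scale_inj vy).
rewrite exprS -signr_odd (negPf gap_even) expr0 mulr1 mulN1r => /eqP.
rewrite subr_eq addrC -subr_eq opprK => /eqP <-; ring.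
Qed.

(** The element c steps before [w] is killed by y, so one side of [y_adx] vanishes. The choice j =
    t+1+c makes the other a multiple of [v y], and c <= q-4-t is the condition j < q-2. *)
Lemma gap_bin c : (0 < c <= q - 4 - t)%N ->
  'C(t.+1 + c, c)%:R * al = 'C(t.+1 + c, c.+1)%:R.
Proof.
move=> /andP[c0 ct].
have := @y_adx (X (K - c) g) (t.+1 + c).
rewrite gch ?br0l; last by nlia.
rewrite back_bracket; [|nlia..].
have -> : (t.+1 + c - c.+1 = t)%N by nlia.
rewrite brZl => /(_ ltac:(nlia)) /(scale_zero vy).
rewrite /sbin exprS mulN1r mulNr -mulrA -mulrBr => /eqP.
by rewrite mulf_eq0 signr_eq0 /= subr_eq0 => /eqP.
Qed.

Lemma gap_bin2 c : (0 < c <= q - 4 - t)%N ->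
  t.+1%:R * 'C(t.+1 + c, c)%:R = 2%:R * 'C(t.+1 + c, c.+1)%:R :> F.
Proof. by move=> cq; rewrite -gap_bin // -gap_type; ring. Qed.

Lemma ppow4 h : (0 < h)%N -> (4 <= p ^ h)%N.
Proof.
by move=> h0; apply: leq_trans p3 _; rewrite -{1}(expn1 p) leq_exp2l //; nlia.
Qed.

(* Both m and q are multiples of the p-part p ^ h of m, hence so is the
   positive difference q - m. *)
Lemma ppart m : (0 < m < q)%N -> m%:R = 0 :> F ->
  exists h r, [/\ (0 < h)%N, m = (r * p ^ h)%N, r%:R != 0 :> F
    & (m + p ^ h = q \/ m + 2 * p ^ h <= q)%N].
Proof.
move=> /andP[m0 mq] /eqP; rewrite -(dvdn_pcharf pF) => pm.
have p_pr := pcharf_prime pF; have pp := prime_gt1 p_pr.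
exists (logn p m), (m %/ p ^ logn p m)%N; split.
- by rewrite logn_gt0 mem_primes p_pr m0.
- by rewrite divnK // pfactor_dvdnn.
- rewrite -(dvdn_pcharf pF) -(@dvdn_pmul2r (p ^ logn p m)) ?expn_gt0 ?prime_gt0 //.
  by rewrite -expnS divnK ?pfactor_dvdnn // pfactor_dvdn // ltnn.
have hn : (logn p m < n)%N.
  rewrite -(ltn_exp2l _ _ pp) -qE; apply: leq_ltn_trans mq.
  by apply: dvdn_leq => //; apply: pfactor_dvdnn.
have /dvdnP[s qs] : (p ^ logn p m %| q)%N by rewrite qE dvdn_exp2l // ltnW.
have ms : (m %/ p ^ logn p m < s)%N.
  by rewrite ltn_divLR ?expn_gt0 ?prime_gt0 // -qs.
have mE := @divnK (p ^ logn p m) m (pfactor_dvdnn _ _).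
case: (ltngtP (m %/ p ^ logn p m).+1 s) => sE; last 1 first.
- by left; rewrite qs -sE mulSnr mE.
- by right; rewrite -{1}mE -mulnDl addn2 qs leq_mul2r sE orbT.
by move: sE; rewrite ltnS leqNgt ms.
Qed.

(** For c+1 = p^h the second binomial of [gap_bin2] equals r, while the factor t+1 is zero. In the
    case t+1 = q - p^h, where this c is out of range, parity decides: q - p^h is even and t+1 is
    odd. *)
Lemma gap_mod1 : t.+1%:R = 0 :> F -> False.
Proof.
move=> t0; have [h [r [h0 tr r0 rq]]] := @ppart t.+1 ltac:(nlia) t0.
have ph := ppow4 h0.
case: rq => [E|rq].
  by have := q_odd; rewrite -E oddD oddX p_odd orbT /= (negPf gap_even).
have := @gap_bin2 (p ^ h).-1 ltac:(nlia).
rewrite t0 mul0r prednK; last by nlia.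
rewrite tr bin_mulppow_eq //; last by nlia.
by move/esym/eqP; rewrite mulf_eq0 (negPf two_neq0) (negPf r0).
Qed.

Lemma gap_mod3 : t.+3%:R = 0 :> F -> False.
Proof.
move=> t0; have [h [r [h0 tr r0 rq]]] := @ppart t.+3 ltac:(nlia) t0.
have ph := ppow4 h0.
have := @gap_bin2 (p ^ h).-1 ltac:(nlia).
(* With t+1 = -2 Pascal's rule merges the two binomials into one. *)
have -> : t.+1%:R = - 2%:R :> F.
  by apply/eqP; rewrite -addr_eq0 -natrD addn2 t0.
rewrite mulNr => /eqP; rewrite eq_sym -addr_eq0 -mulrDr -natrD -binS.
rewrite prednK; last by nlia.
have -> : (t.+1 + (p ^ h).-1).+1 = (r * p ^ h + (p ^ h - 2))%N by nlia.
rewrite bin_mulppow_eq //; last by nlia.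
by rewrite mulf_eq0 (negPf two_neq0) (negPf r0).
Qed.

Lemma gap_mod2 : t.+2%:R = 0 :> F -> False.
Proof.
move=> t0; have [h [r [h0 tr r0 rq]]] := @ppart t.+2 ltac:(nlia) t0.
have ph := ppow4 h0.
case: rq => [E|rq]; last first.
  have := @gap_bin2 (p ^ h).-1 ltac:(nlia).
  rewrite prednK; last by nlia.
  have -> : (t.+1 + (p ^ h).-1)%N = (r * p ^ h + (p ^ h - 2))%N by nlia.
  rewrite bin_mulppow_eq //; last by nlia.
  rewrite (bin_mulppow_lt pF); last by nlia.
  rewrite bin_small ?mulr0; last by nlia.
  by move/esym/eqP; rewrite mulf_eq0 (negPf two_neq0) (negPf r0).
(* Here t+2 = q - p^h, and c = p^h - 1 exceeds the range of [gap_bin] by one. Instead both x and y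
   are shown to kill [v y], against the covering property. *)
have te := gap_even.
have t1 : t.+1%:R = - 1 :> F by apply/eqP; rewrite -addr_eq0 natr1 t0.
have E2 := gap_type; rewrite t1 in E2.
have al0 : al != 0.
  by apply/eqP => al0; move/eqP: E2; rewrite al0 mulr0 eq_sym oppr_eq0 oner_eq0.
(* One step before [w], with j = t+3, the coefficient of [v x y] is -al, as t+3 = 1 and 'C(t+3, 2) =
   0 in F. *)
have vxy : v ** x ** y = 0.
  have := @y_adx (X (K - 1) g) t.+3.
  rewrite gch ?br0l; last by nlia.
  rewrite back_bracket; [|nlia..].
  rewrite (_ : (t.+3 - 2 = t.+1)%N) ?subSS ?subn0 // adxS => /(_ ltac:(nlia)).
  rewrite brZl => /eqP; rewrite scaler_eq0 => /orP[|/eqP] //.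
  have C0 : 'C(t.+3, 2)%:R = 0 :> F.
    apply/eqP; move/eqP: (bin2F t.+2).
    by rewrite t0 mulr0 mulf_eq0 (negPf two_neq0).
  rewrite /sbin C0 mulr0 addr0 bin1 expr1 -natr1 t0 add0r.
  by rewrite mulf_eq0 (negPf al0) mulr1 oppr_eq0 oner_eq0.
have vyx : v ** y ** x = 0.
  have := @y_adx (w ** x) t.+1.
  rewrite wx_bracket (tail1 zch) adxS vxy subr0 t1 scaleN1r scalerN.
  move=> /(_ ltac:(nlia))/eqP; rewrite eq_sym oppr_eq0 scaler_eq0 signr_eq0.
  by move/eqP.
have vyy : v ** y ** y = 0.
  have := @y_adx (w ** y) t.+1.
  rewrite (tail0 (wy_chain zch)) adx_wy wyy br0l !brZl scalerA.
  move=> /(_ ltac:(nlia))/eqP; rewrite scaler_eq0 mulf_eq0 signr_eq0 (negPf al0).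
  by move/eqP.
by move/eqP: vy; apply; apply: (@cov0 i).
Qed.

Lemma gap_lower : t = (q - 5)%N /\ al = - 2%:R.
Proof.
suff tE : t = (q - 5)%N.
  split=> //; apply: (mulfI two_neq0); rewrite gap_type tE.
  have -> : (q - 5).+1 = (q - 4)%N by nlia.
  by rewrite natrB ?qF; [ring | nlia].
have te := gap_even.
have [tq6|tq6] := leqP t (q - 6); last first.
  suff : t <> (q - 4)%N by nlia.
  by move=> tE; have := q_odd; rewrite -(@subnK 4 q) ?oddD -?tE ?(negPf te) //; nlia.
(* c = 2 is the first value that says more than [gap_type]: it gives (t+1)(t+2)(t+3) = 0 in F. *)
exfalso; have := @gap_bin2 2 ltac:(nlia).
have T3 : 3%:R * 'C(t.+3, 3)%:R = t.+3%:R * 'C(t.+2, 2)%:R :> F.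
  by rewrite -!natrM -(mul_bin_diag t.+3 2).
rewrite addn2 => /(congr1 (fun u => 3%:R * u)).
rewrite [RHS]mulrCA T3.
move=> E; have : t.+1%:R * t.+2%:R * t.+3%:R = 0 :> F.
  have := bin2F t.+2; have := bin2F t.+1.
  move: E; move: ('C(t.+3, 2)%:R : F) ('C(t.+2, 2)%:R : F) => A B E EB EA.
  have : 2%:R * (3%:R * (t.+1%:R * A)) = 2%:R * (2%:R * (t.+3%:R * B)) :> F by rewrite E.
  rewrite (_ : 2%:R * (3%:R * (t.+1%:R * A)) = 3%:R * t.+1%:R * (2%:R * A)); last by ring.
  rewrite (_ : 2%:R * (2%:R * (t.+3%:R * B)) = 2%:R * t.+3%:R * (2%:R * B)); last by ring.
  rewrite EA EB => /eqP; rewrite -subr_eq0 => /eqP <-; ring.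
move/eqP; rewrite !mulf_eq0 => /orP[/orP[]|] /eqP.
- exact: gap_mod1.
- exact: gap_mod2.
- exact: gap_mod3.
Qed.

End LowerBound.

End Datum.

Lemma mem_adx i k a : (0 < i)%N -> a \in gcomp L i -> X k a \in gcomp L (i + k).
Proof.
move=> i0 ai; elim: k => [|k IHk]; first by rewrite addn0.
by rewrite addnS adxS; apply: memx => //; nlia.
Qed.

Lemma mem_u k : X k y \in gcomp L k.+1.
Proof. by rewrite -add1n; apply: mem_adx. Qed.

(** Restarting the chain j steps before its end gives, for varying j, relations with different
    coefficients between the same three elements. *)
Lemma end_rel2_back a m j : chain a y m -> (0 < j <= m)%N -> (j.+2 < q - 2)%N ->
  'C(j.+2, 2)%:R *: (X m a ** y ** x ** x ** y)
    - j.+2%:R *: (X m a ** x ** y ** x ** y) + X m a ** x ** x ** y ** y = 0.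
Proof.
move=> ch /andP[j0 jm] jq; rewrite -{1 2 3}(subnKC jm) adxD.
by apply: end_rel2 => //; apply: chain_adx; rewrite subnKC.
Qed.

Lemma br_x_neq0 i a : (0 < i)%N -> a \in gcomp L i -> a != 0 -> a ** y = 0 ->
  a ** x != 0.
Proof.
move=> i0 ai a0 ay; apply: contra_neq a0 => ax; exact: (cov0 i0 ai).
Qed.

Lemma chain_neq0 i k a : (0 < i)%N -> a \in gcomp L i -> a != 0 -> chain a y k ->
  X k a != 0.
Proof.
move=> i0 ai a0; elim: k => // k IHk ch.
apply: (@br_x_neq0 (i + k)); [nlia|exact: mem_adx| |exact: ch].
by apply: IHk; apply: chainW ch.
Qed.

Lemma chain_first a k : chain a y k \/
  exists2 t, (t < k)%N & chain a y t /\ X t a ** y != 0.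
Proof.
elim: k => [|k [IHk|[t tk H]]]; first by left.
- have [E|E] := eqVneq (X k a ** y) 0; last by right; exists k.
  by left=> l; rewrite ltnS leq_eqVlt => /orP[/eqP-> //|/IHk].
- by right; exists t => //; apply: ltnW.
Qed.

Lemma nq j : (j <= q)%N -> (q - j)%:R = - j%:R :> F.
Proof. by move=> jq; rewrite natrB // qF sub0r. Qed.

Local Notation U := (X q.-1 y).
Local Notation om := (X q.-1 y ** y).

Lemma sbin_U k : (k < q)%N -> sbin F q.-1 k = 1.
Proof. by rewrite qE; apply: sbin_ppow_pred. Qed.

Lemma br_om a : a ** om = a ** U ** y - a ** y ** U.
Proof. exact: brA. Qed.

Lemma y_chain : chain y y (q - 2). Proof. by move=> k /uy. Qed.

(* The case [t = q - 5], [al = -2] which [gap_lower] leaves open. *)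
Section GapMinusOne.

Variable w : L.
Local Notation z := (w ** x ** y).
Hypothesis wxx : w ** x ** x = 0.
Hypothesis wyx : w ** y ** x = - 2%:R *: z.
Variable i : nat.
Hypothesis i0 : (0 < i)%N.
Hypothesis wi : w \in gcomp L i.
Local Notation v := (X (q - 5) z).
Hypothesis zch : chain z y (q - 5).
Hypothesis vy : v ** y != 0.

Lemma gap_vi : v \in gcomp L (i + q - 3).
Proof.
have ? := q7; have -> : (i + q - 3 = i.+2 + (q - 5))%N by nlia.
by apply: mem_adx => //; apply: memy => //; apply: memx.
Qed.

Lemma gap_sign : (-1) ^+ (q - 5) = 1 :> F.
Proof.
have ? := q7; rewrite -signr_odd oddB; last by nlia.
by rewrite q_odd.
Qed.

(** The last two clauses put [v] in the position before a diamond of type 2, where al = -1/2. *)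
Lemma gap_end : [/\ v ** y ** y = 0, v ** y ** x ** y = 0,
  v ** x ** y ** y = 0, v ** x ** y = - 2%:R *: (v ** y ** x)
  & v ** y ** x != 0].
Proof.
have ? := q7.
have [vyy vyxy vxyy] := end_chain zch erefl ltac:(nlia).
split=> //.
  (* As q = 0 in F, this relation reads 2 [v x y] = -4 [v y x]. *)
  have := @y_adx (w ** x) (q - 5).+1 ltac:(nlia).
  rewrite wx_bracket // (tail1 zch) gap_sign scale1r adxS.
  have -> : (q - 5).+1%:R = - 2%:R * 2%:R :> F.
    by rewrite (_ : (q - 5).+1 = q - 4)%N ?nq; [ring|nlia..].
  move=> E; apply: (scalerI two_neq0).
  by rewrite scaler_nat mulr2n {1}E subrK scalerA mulrC.
apply: contra_neq vy => vyx; apply: (@cov0 (i + q - 3).+1) => //.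
by apply: memy gap_vi; nlia.
Qed.

(* For a diamond after the second, [s] is the datum of the preceding one;
   bracketing [s] with [om x^k] for k = q-5 and q-4, where [om x^k y] = 0,
   yields two independent conditions on [a] and [b]. *)
Section Previous.

Variables (s z0 : L) (a b : F).
Hypothesis sxx : s ** x ** x = 0.
Hypothesis syy : s ** y ** y = 0.
Hypothesis syx : s ** y ** x = a *: z0.
Hypothesis sxy : s ** x ** y = b *: z0.
Hypothesis ab : (a != 0) || (b != 0).
Hypothesis z0ch : chain z0 y (q - 3).
Hypothesis z0w : X (q - 3) z0 = w.
Hypothesis omch : chain om y (q - 3).

Let zy : z ** y = 0.
Proof. by apply: (zch (k := 0)); have := q7; nlia. Qed.

(** With all signed binomials equal to 1, [back_bracket] has the coefficient al + 1 = -1. *)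
Let z0U k : (k <= q - 3)%N -> X k z0 ** U = - X k.+1 z.
Proof.
move=> kq; have ? := q7.
have := @back_bracket w z0 (q - 3) (- 2%:R) wxx wyx z0w z0ch (q - 3 - k) q.-1.
rewrite subKn // => ->; [|nlia..].
rewrite !sbin_U ?mul1r; [|nlia..].
rewrite (_ : q.-1 - (q - 3 - k).+1 = k.+1)%N; last by nlia.
by rewrite (_ : - 2%:R + 1 = -1) ?scaleN1r //; ring.
Qed.

Let z0om k : (k < q - 3)%N -> X k z0 ** om = - (X k.+1 z ** y).
Proof.
move=> kq; rewrite br_om z0U ?(ltnW kq) // z0ch // br0l subr0.
by rewrite brNl.
Qed.

Let adx_sy k : X k.+1 (s ** y) = a *: X k z0.
Proof. by rewrite adxSr syx adxZ. Qed.

Let adx_s k : (2 <= k)%N -> X k s = 0.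
Proof. by move=> k2; apply: (adx_eq0 k2). Qed.

Let syU : s ** y ** U = - a *: z.
Proof.
have ? := q7; rewrite (@leibniz2 _ _ _ _ _ _ (q - 2)) => [|[|k] kq|k]; last by nlia.
- rewrite !sbin_U ?scale1r; [|nlia..].
  rewrite (_ : q.-1 - (q - 2) = 1)%N; last by nlia.
  rewrite (_ : q.-1 - (q - 2).+1 = 0)%N; last by nlia.
  rewrite (_ : q - 2 = (q - 3).+1)%N; last by nlia.
  rewrite !adx_sy !adxS !adx0 z0w !brZl wyx scalerA -scalerDl.
  by congr (_ *: _); ring.
- exact: syy.
by rewrite adx_sy brZl z0ch ?scaler0 //; nlia.
Qed.

Let syom : s ** y ** om = 0.
Proof. by rewrite br_om syU syy br0l brZl zy scaler0 subr0. Qed.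

Let som : s ** om = (2%:R * a + b) *: z.
Proof.
have ? := q7; rewrite br_om syU (@leibniz2 _ _ _ _ _ _ 0) // => [|k ?]; last first.
  by rewrite adx_s ?br0l //; nlia.
rewrite !sbin_U ?scale1r; [|nlia..].
rewrite subn0 adx0 (_ : q.-1 = (q - 2).+1) ?adx_sy; last by nlia.
rewrite subSS subn0 /= sxy adxZ -scalerDl brZl (_ : q - 2 = (q - 3).+1)%N; last by nlia.
by rewrite adxS z0w scaleNr opprK -scalerDl; congr (_ *: _); ring.
Qed.

Let sxom : s ** x ** om = b *: (z ** x).
Proof.
have ? := q7; rewrite br_om sxy (@leibniz1 _ _ _ _ _ _ 0) // => [|[|k] // _]; last first.
  by rewrite adxSr sxx adx00 br0l.
have z00 : X q.-1 z0 = 0 by rewrite (_ : q.-1 = (q - 3).+2) ?adxS ?z0w //; nlia.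
rewrite sbin0 scale1r subn0 /= sxy adxZ z00 scaler0 br0l sub0r brZl.
by rewrite (z0U (k := 0)) // scalerN opprK.
Qed.

Let s_om k : s ** X k om = (2%:R * a + b - k%:R * b) *: X k z.
Proof.
rewrite (@leibniz2 _ _ _ _ _ _ 0) // => [|l ?]; last first.
  by rewrite adx_s ?br0l //; nlia.
rewrite subn0 sbin0 scale1r som /= sxom !adxZ /sbin bin1 expr1 mulN1r.
case: k => [|k]; first by rewrite oppr0 scale0r addr0 mul0r subr0.
by rewrite subSS subn0 -adxSr scalerA -scalerDl; congr (_ *: _); ring.
Qed.

Let sy_chain : chain (s ** y) om (q - 5).
Proof.
move=> [|k] kq; first exact: syom.
rewrite adx_sy brZl z0om; last by nlia.
by rewrite zch ?oppr0 ?scaler0 //; nlia.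
Qed.

Let sy_end : X (q - 5) (s ** y) ** om = - a *: (v ** y).
Proof.
have ? := q7; rewrite (_ : q - 5 = (q - 6).+1)%N; last by nlia.
rewrite adx_sy brZl z0om; last by nlia.
by rewrite scaleNr scalerN.
Qed.

Let sy_end1 : X (q - 5).+1 (s ** y) ** om = - a *: (v ** x ** y).
Proof.
have ? := q7; rewrite adx_sy brZl z0om; last by nlia.
by rewrite scaleNr scalerN.
Qed.

Let s_y_om k : (k < q - 3)%N -> s ** X k om ** y = s ** y ** X k om.
Proof. by move/omch => E; apply/eqP; rewrite -subr_eq0 -brA E br0r. Qed.

Lemma gap_previous : False.
Proof.
have ? := q7; have [vyy vyxy vxyy vxyE vyx] := gap_end.
(* Both sides of [s_y_om] are multiples of [v y] for k = q-5 and, by [vxyE], of [v x y] for k =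
   q-4. *)
have E1 : 3%:R * (a + 2%:R * b) = 0.
  apply: (scale_zero vy); have := @s_y_om (q - 5) ltac:(nlia).
  rewrite s_om brZl (tail0 sy_chain) gap_sign scale1r sy_end nq; last by nlia.
  move/eqP; rewrite -subr_eq0 -scalerBl => /eqP <-; congr (_ *: _); ring.
have E2 : 3%:R * a + 5%:R * b = 0.
  have vxy : v ** x ** y != 0.
    by rewrite vxyE scaler_eq0 oppr_eq0 (negPf vyx) (negPf two_neq0).
  apply: (scale_zero vxy); have := @s_y_om (q - 5).+1 ltac:(nlia).
  rewrite s_om brZl (tail1 sy_chain) gap_sign scale1r sy_end sy_end1.
  rewrite brZl (_ : (q - 5).+1 = (q - 4)%N) ?nq; [|nlia..].
  rewrite -[in LHS](_ : (q - 5).+1 = (q - 4)%N) ?adxS; last by nlia.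
  have -> : v ** y ** x = - 2%:R^-1 *: (v ** x ** y).
    by rewrite vxyE scalerA mulrNN mulVf ?two_neq0 ?scale1r.
  move/eqP; rewrite !scalerA -scalerBl -subr_eq0 -scalerBl => /eqP <-.
  by congr (_ *: _); field; apply: two_neq0.
have b0 : b = 0.
  apply/eqP; rewrite -oppr_eq0; apply/eqP.
  transitivity (3%:R * a + 5%:R * b - 3%:R * (a + 2%:R * b)); first by ring.
  by rewrite E1 E2 subr0.
move: E2 ab; rewrite b0 mulr0 addr0 eqxx orbF => /eqP.
by rewrite mulf_eq0 (negPf three_neq0) => /= ->.
Qed.

End Previous.

End GapMinusOne.

(* For the second diamond the contradiction shows only two diamonds later:
   [v] would precede a diamond of type 2, the next chain starts at [th] and
   ends at [v2], and the brackets of the elements [om x^k] with each other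
   force [v2 y x x x] = 0. *)
Section SecondDiamond.

Local Notation v1 := (X (q - 2) y).
Hypothesis v1yx : v1 ** y ** x = - 2%:R *: om.
Local Notation v := (X (q - 5) om).
Hypothesis omch : chain om y (q - 5).
Hypothesis vy : v ** y != 0.
Local Notation th := (v ** x ** y).
Local Notation v2 := (X (q - 3) th).

Let v1x : v1 ** x = U.
Proof. by rewrite -adxS; congr (X _ y); have := q7; nlia. Qed.

Let ge7 : (7 <= q)%N := q7.

(** The parameter [al] of the diamond of type 2. *)
Let half : F := - 2%:R^-1.

Let vv : [/\ v ** y ** y = 0, v ** y ** x ** y = 0,
  v ** x ** y ** y = 0, th = - 2%:R *: (v ** y ** x)
  & v ** y ** x != 0].
Proof.
have ch := omch; have vy' := vy.
rewrite -!v1x in ch vy' *; apply: (@gap_end v1 _ q.-1 _ _ ch vy') => //.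
- by rewrite v1x -adxS prednK ?(adxq (i := 1)) //; nlia.
- by nlia.
- by rewrite (_ : q.-1 = (q - 2).+1)%N ?mem_u //; nlia.
Qed.

Let U_mem : U \in gcomp L q.
Proof. by rewrite [X in gcomp L X](_ : q = q.-1.+1) ?mem_u //; nlia. Qed.

Let om_mem : om \in gcomp L q.+1.
Proof. by apply: memy => //; nlia. Qed.

Let v_mem : v \in gcomp L (2 * q - 4).
Proof. by rewrite (_ : 2 * q - 4 = q.+1 + (q - 5))%N ?mem_adx //; nlia. Qed.

Let th_mem : th \in gcomp L (2 * q - 2).
Proof.
rewrite (_ : 2 * q - 2 = (2 * q - 4).+2)%N; last by nlia.
by apply: memy => //; apply: memx => //; nlia.
Qed.

Let th0 : th != 0.
Proof.
case: vv => _ _ _ -> vyx.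
by rewrite scaler_eq0 oppr_eq0 (negPf vyx) (negPf two_neq0).
Qed.

Let vyxE : v ** y ** x = half *: th.
Proof.
case: vv => _ _ _ -> _.
by rewrite scalerA mulrNN mulVf ?two_neq0 ?scale1r.
Qed.

Let thy : th ** y = 0. Proof. by case: vv. Qed.

(** [om] is a multiple of [v1 y x], so one of the q factors x is already present. *)
Let adxq_om : X q.-1 om = 0.
Proof.
have : X q.-1 (v1 ** y ** x) = 0.
  rewrite -adxSr prednK; last by nlia.
  apply: (adxq (i := q)); first by nlia.
  rewrite [X in gcomp L X](_ : q = (q - 2).+2); last by nlia.
  by apply: memy => //; apply: mem_u.
rewrite v1yx adxZ => /eqP.
by rewrite scaler_eq0 oppr_eq0 (negPf two_neq0) => /eqP.
Qed.

(** By covering, [v x x] = l [v y x], whence l [v y x x x] = [om x^(q-1)] = 0. But [v y x x x] is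
    nonzero, because y kills [v y x] and [v y x x]. *)
Let vxx : v ** x ** x = 0.
Proof.
have [vyy vyxy vxyy thE vyx] := vv.
have vy_mem : v ** y \in gcomp L (2 * q - 3).
  by rewrite (_ : 2 * q - 3 = (2 * q - 4).+1)%N ?memy //; nlia.
have vyx_mem : v ** y ** x \in gcomp L (2 * q - 2).
  by rewrite (_ : 2 * q - 2 = (2 * q - 3).+1)%N ?memx //; nlia.
have [l [m]] : exists s t : F, v ** x ** x = s *: (v ** y ** x) + t *: (v ** y ** y).
  apply: (@cov (2 * q - 3)) => //; first by nlia.
  rewrite (_ : (2 * q - 3).+1 = (2 * q - 4).+2)%N; last by nlia.
  by apply: memx => //; apply: memx => //; nlia.
rewrite vyy scaler0 addr0 => E.
have vyxxy : v ** y ** x ** x ** y = 0.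
  have := @end_rel2_back om (q - 5) 1 omch ltac:(nlia) ltac:(nlia).
  rewrite E thE !brZl vyxy br0l scaler0 addr0 scalerA -scalerBl => /eqP.
  rewrite scaler_eq0 => /orP[/eqP E9|/eqP //]; exfalso; move/eqP: E9; apply/negP.
  rewrite (_ : _ - _ = 3%:R * 3%:R) ?mulf_neq0 ?three_neq0 //.
  by rewrite (_ : 'C(3, 2) = 3%N) //; ring.
have vyxx : v ** y ** x ** x != 0.
  by apply: (@br_x_neq0 (2 * q - 2)) => //; nlia.
have vyxxx : v ** y ** x ** x ** x != 0.
  apply: (@br_x_neq0 (2 * q - 2).+1) => //; apply: memx => //; nlia.
suff l0 : l = 0 by rewrite E l0 scale0r.
apply: (scale_zero vyxxx); rewrite -2!brZl -E -!adxS.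
by rewrite (_ : (q - 5).+4 = q.-1)%N //; nlia.
Qed.

(* The next diamond after [th] is at the regular distance, since its type
   is not -1. *)
Let thch : chain th y (q - 3).
Proof.
have [//|[t tq [ch ty]]] := chain_first th (q - 3); exfalso.
have [vyy _ _ _ _] := vv.
have t0 : (0 < t)%N by case: t {tq ch} ty => //=; rewrite thy eqxx.
have vt : X t th ** y \in gcomp L (2 * q - 2 + t).+1.
  by apply: memy; [nlia|apply: mem_adx => //; nlia].
have [_ /eqP] := @gap_lower v om (q - 5) half vxx vyy vyxE erefl omch
  (2 * q - 2 + t).+1 t isT vt ch ty ltac:(nlia) ltac:(nlia).
rewrite eqr_opp => /eqP /(congr1 (fun u => 2%:R * u)).
rewrite mulfV ?two_neq0 // => /eqP; rewrite eq_sym -subr_eq0.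
by rewrite (_ : _ - _ = 3%:R) ?(negPf three_neq0) //; ring.
Qed.

Let adxq_th : X q.-1 th = 0.
Proof.
have [_ _ _ -> _] := vv; rewrite adxZ -adxSr prednK; last by nlia.
rewrite (adxq (i := 2 * q - 3)) ?scaler0 //; first by nlia.
by rewrite (_ : 2 * q - 3 = (2 * q - 4).+1)%N ?memy //; nlia.
Qed.

Let v2xx : v2 ** x ** x = 0.
Proof. by rewrite -!adxS (_ : (q - 3).+2 = q.-1) //; nlia. Qed.

Let omU k : (k <= q - 5)%N -> X k om ** U = (1 + half) *: X (k + 3) th.
Proof.
have [vyy _ _ _ _] := vv => kq.
have := @back_bracket v om (q - 5) half vxx vyxE erefl omch (q - 5 - k) q.-1.
rewrite subKn // => ->; [|nlia..].
rewrite !sbin_U ?mul1r ?(addrC half); [|nlia..].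
by congr (_ *: X _ th); nlia.
Qed.

Let halfE : 1 + half = 2%:R^-1.
Proof. by rewrite /half; field; apply: two_neq0. Qed.

Let omom k : (k < q - 5)%N -> X k om ** om = 2%:R^-1 *: (X (k + 3) th ** y).
Proof.
move=> kq; rewrite br_om omU ?(ltnW kq) // omch // br0l subr0 brZl.
by rewrite halfE.
Qed.

Let omom0 : chain om om (q - 6).
Proof. by move=> k kq; rewrite omom ?thch ?scaler0 //; nlia. Qed.

Let omom_end : X (q - 6) om ** om = 2%:R^-1 *: (v2 ** y).
Proof.
rewrite omom; last by nlia.
by congr (_ *: (X _ _ ** y)); nlia.
Qed.

Let vyU : v ** y ** U = half *: (v2 ** y ** x + v2 ** x ** y).
Proof.
have [vyy _ _ _ _] := vv.
rewrite (@leibniz2 _ _ _ _ _ _ (q - 2)) => [|[|k] kq|k]; last by nlia.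
- rewrite !sbin_U ?scale1r; [|nlia..].
  rewrite (_ : q.-1 - (q - 2) = 1)%N; last by nlia.
  rewrite (_ : q.-1 - (q - 2).+1 = 0)%N; last by nlia.
  rewrite (_ : q - 2 = (q - 3).+1)%N; last by nlia.
  by rewrite !(adxSr _ _ (v ** y)) vyxE !adxZ scalerDr !brZl !adxZ.
- exact: vyy.
by rewrite adxSr vyxE adxZ brZl thch ?scaler0 //; nlia.
Qed.

Let vom : v ** om = v2 ** x ** y + 2%:R^-1 *: (v2 ** y ** x).
Proof.
rewrite br_om vyU omU // halfE (_ : q - 5 + 3 = (q - 3).+1)%N; last by nlia.
rewrite adxS brZl /half scaleNr opprK scalerDr addrCA -scalerDl addrC.
by rewrite (_ : 2%:R^-1 + 2%:R^-1 = 1) ?scale1r //; field; apply: two_neq0.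
Qed.

Let vxom : v ** x ** om = - (v2 ** y ** x ** x + v2 ** x ** y ** x).
Proof.
rewrite br_om wx_bracket ?vxx // adxq_th br0l sub0r.
rewrite (@leibniz3 _ _ _ _ _ _ (q - 3)) => [|//|k]; last by nlia.
rewrite !sbin_U ?scale1r; [|nlia..].
rewrite (_ : q.-1 - (q - 3) = 2)%N; last by nlia.
rewrite (_ : q.-1 - (q - 3).+1 = 1)%N; last by nlia.
rewrite (_ : q.-1 - (q - 3).+2 = 0)%N; last by nlia.
by rewrite !adxS !adx0 v2xx br0l addr0.
Qed.

(** The bracket of [om x^m] with itself vanishes; for m = (q-5)/2 its expansion involves only the
    brackets of [om x^(q-6)] and [om x^(q-5)] with [om]. *)
Let v2_type : 4%:R *: (v2 ** x ** y) = - 7%:R *: (v2 ** y ** x).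
Proof.
pose m := (q - 5)./2; have m2 : (m.*2 = q - 5)%N.
  rewrite -[RHS]odd_double_half (_ : odd (q - 5) = false) // oddB ?q_odd //; nlia.
have ch : chain (X m om) om m.-1.
  by move=> k km; rewrite -adxD omom0 //; nlia.
have := tail1 ch; rewrite prednK; last by nlia.
rewrite bracket_alt -adxD -adxS -addSn prednK; last by nlia.
rewrite (_ : m.-1 + m = q - 6)%N; last by nlia.
rewrite addnn m2 omom_end vom => /esym/eqP.
rewrite scaler_eq0 signr_eq0 /= brZl => /eqP E.
have mF : 2%:R * m%:R = - 5%:R :> F by rewrite -natrM mul2n m2 nq //; nlia.
move/eqP: E; rewrite subr_eq0 scalerA -subr_eq -scalerBl => /eqP <-.
rewrite scalerA; congr (_ *: _).
transitivity (2%:R * m%:R - 2%:R : F); last by rewrite mF; ring.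
by field; apply: two_neq0.
Qed.

Let C2 : 'C(q - 3, 2)%:R = 6%:R :> F.
Proof.
apply: (mulfI two_neq0); rewrite (_ : q - 3 = (q - 4).+1)%N; last by nlia.
rewrite bin2F (_ : (q - 4).+1 = q - 3)%N ?nq; [ring|nlia..].
Qed.

Let C3 : 'C(q - 3, 3)%:R = - 10%:R :> F.
Proof.
apply: (mulfI three_neq0); rewrite -natrM -(mul_bin_diag (q - 3) 2) natrM.
rewrite (_ : (q - 3).-1 = (q - 5).+1)%N; last by nlia.
have -> : 'C((q - 5).+1, 2)%:R = 10%:R :> F.
  apply: (mulfI two_neq0); rewrite bin2F (_ : (q - 5).+1 = q - 4)%N ?nq; [ring|nlia..].
by rewrite nq; [ring|nlia].
Qed.

(** Expands the bracket of [om] with [om x^(q-3)] = [v x x] = 0, where only k = q-6, q-5, q-4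
    survive. *)
Let omom_rel :
  5%:R *: (v2 ** y ** x ** x ** x) + 3%:R *: (v2 ** x ** y ** x ** x) = 0.
Proof.
have : om ** X (q - 3) om = 0.
  by rewrite (_ : q - 3 = (q - 5).+2)%N ?adxS ?vxx ?br0r //; nlia.
rewrite (@leibniz3 _ _ _ _ _ _ (q - 6)) => [|//|k kq]; last first.
  rewrite (_ : k = (q - 5).+2)%N; last by nlia.
  by rewrite !adxS vxx br0l.
have sg j : odd j -> (j <= q)%N -> (-1) ^+ (q - j) = 1 :> F.
  by move=> jo jq; rewrite -signr_odd oddB // q_odd jo.
have -> : sbin F (q - 3) (q - 6) = 10%:R.
  rewrite /sbin (_ : q - 6 = q - 3 - 3)%N; last by nlia.
  rewrite bin_sub ?C3; last by nlia.
  rewrite (_ : q - 3 - 3 = (q - 7).+1)%N; last by nlia.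
  by rewrite exprS sg //; ring.
have -> : sbin F (q - 3) (q - 6).+1 = 6%:R.
  rewrite /sbin (_ : (q - 6).+1 = q - 3 - 2)%N; last by nlia.
  rewrite bin_sub ?C2; last by nlia.
  rewrite (_ : q - 3 - 2 = q - 5)%N; last by nlia.
  by rewrite sg //; [ring|nlia].
have -> : sbin F (q - 3) (q - 6).+2 = 3%:R.
  rewrite /sbin (_ : (q - 6).+2 = q - 3 - 1)%N; last by nlia.
  rewrite bin_sub ?bin1; last by nlia.
  rewrite nq; last by nlia.
  rewrite (_ : q - 3 - 1 = (q - 5).+1)%N; last by nlia.
  by rewrite exprS sg; [ring| |nlia].
rewrite (_ : q - 3 - (q - 6) = 3)%N; last by nlia.
rewrite (_ : q - 3 - (q - 6).+1 = 2)%N; last by nlia.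
rewrite (_ : q - 3 - (q - 6).+2 = 1)%N; last by nlia.
rewrite omom_end (_ : (q - 6).+2 = (q - 5).+1)%N; last by nlia.
rewrite (_ : (q - 6).+1 = q - 5)%N; last by nlia.
rewrite (adxS _ (q - 5)) vom vxom /= !brDl !brNl !brZl !brDl.
move: (v2 ** y ** x ** x ** x) (v2 ** x ** y ** x ** x) => A B.
rewrite !scalerDr !scalerN !scalerDr !scalerA opprD => E; rewrite -[RHS]E.
rewrite (_ : 10%:R / 2%:R = 5%:R); last by field; apply: two_neq0.
rewrite (_ : 6%:R / 2%:R = 3%:R); last by field; apply: two_neq0.
rewrite -opprD (addrC (3%:R *: A)) opprD -addrA addrACA subrr addr0 -scalerBl.
by congr (_ + _ *: _); ring.
Qed.

Lemma second_gap : False.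
Proof.
have v2_mem : v2 \in gcomp L (3 * q - 5).
  by rewrite (_ : 3 * q - 5 = 2 * q - 2 + (q - 3))%N ?mem_adx //; nlia.
have v20 : v2 != 0 by apply: (chain_neq0 _ th_mem) => //; nlia.
have [v2yy v2yxy v2xyy] := end_chain thch erefl ltac:(nlia).
have v2y_mem : v2 ** y \in gcomp L (3 * q - 4).
  by rewrite (_ : 3 * q - 4 = (3 * q - 5).+1)%N ?memy //; nlia.
have v2x_mem : v2 ** x \in gcomp L (3 * q - 4).
  by rewrite (_ : 3 * q - 4 = (3 * q - 5).+1)%N ?memx //; nlia.
have [v2y|v2y] := eqVneq (v2 ** y) 0.
  have /negP[] := br_x_neq0 (i := 3 * q - 5) ltac:(nlia) v2_mem v20 v2y.
  apply/eqP; apply: (@cov0 (3 * q - 4)) => //; first by nlia.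
  have := v2_type; rewrite v2y br0l scaler0 => /eqP; rewrite scaler_eq0.
  by rewrite (negPf four_neq0) => /eqP.
have v2yx : v2 ** y ** x != 0 by apply: (br_x_neq0 _ v2y_mem) => //; nlia.
have v2yx_mem : v2 ** y ** x \in gcomp L (3 * q - 3).
  by rewrite (_ : 3 * q - 3 = (3 * q - 4).+1)%N ?memx //; nlia.
have v2yxx : v2 ** y ** x ** x != 0 by apply: (br_x_neq0 _ v2yx_mem) => //; nlia.
have v2yxx_mem : v2 ** y ** x ** x \in gcomp L (3 * q - 2).
  by rewrite (_ : 3 * q - 2 = (3 * q - 3).+1)%N ?memx //; nlia.
(* The relations for j = 1 and j = 2 are independent in [v2 y x x y] and [v2 x y x y]. *)
have v2yxxy : v2 ** y ** x ** x ** y = 0.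
  have E1 := end_rel2_back (j := 1) thch ltac:(nlia) ltac:(nlia).
  have E2 := end_rel2_back (j := 2) thch ltac:(nlia) ltac:(nlia).
  rewrite v2xx !br0l addr0 (_ : 'C(3, 2) = 3)%N // -scalerBr in E1.
  rewrite v2xx !br0l addr0 (_ : 'C(4, 2) = 6)%N // in E2.
  move/eqP: E1; rewrite scaler_eq0 (negPf three_neq0) subr_eq0 => /eqP E1.
  move: E2; rewrite -E1 -scalerBl => /eqP; rewrite scaler_eq0 -natrB //.
  by rewrite (negPf two_neq0) => /eqP.
have /negP[] := br_x_neq0 (i := 3 * q - 2) ltac:(nlia) v2yxx_mem v2yxx v2yxxy.
(* With A = [v2 y x x x] and B = [v2 x y x x], 4B = -7A turns 4(5A + 3B) = 0 into -A = 0. *)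
have T : 4%:R *: (v2 ** x ** y ** x ** x) = - 7%:R *: (v2 ** y ** x ** x ** x).
  by rewrite -2!brZl v2_type !brZl.
have /eqP : 4%:R *: (5%:R *: (v2 ** y ** x ** x ** x)
  + 3%:R *: (v2 ** x ** y ** x ** x)) = 0 by rewrite omom_rel scaler0.
rewrite scalerDr !scalerA (mulrC 4%:R 3%:R) -(scalerA 3%:R) T scalerA -scalerDl.
by rewrite scaler_eq0 (_ : _ + _ = - 1) ?oppr_eq0 ?oner_eq0 //; ring.
Qed.

End SecondDiamond.

(** * Passing from one diamond to the next *)

Section Diamonds.

Local Notation v1 := (X (q - 2) y).
Hypothesis v1yx : v1 ** y ** x = - 2%:R *: om.
Hypothesis om0 : om != 0.
Hypothesis y0 : y != 0.
Hypothesis nonzero : forall i, (0 < i)%N -> exists2 a, a \in gcomp L i & a != 0.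

(** A chain before a diamond has at least q-3 steps, but the [w] of a fake diamond lies one step
    before its end. The remaining q-4 steps suffice for [gap_lower] whatever t is. *)
Definition prechain e w := exists g j K,
  [/\ (0 < j)%N, (j + K = e.-1)%N, (q - 4 <= K)%N
    & [/\ g \in gcomp L j, X K g = w & chain g y K]].

(** What [gap_previous] needs about the preceding diamond. The pair (a, b) is projective, so that b
    = 0 covers a fake diamond read as type 0. *)
Definition prediamond w := exists s z0 (a b : F),
  [/\ [/\ s ** x ** x = 0, s ** y ** y = 0, s ** y ** x = a *: z0
        & s ** x ** y = b *: z0],
      (a != 0) || (b != 0), chain z0 y (q - 3) & X (q - 3) z0 = w].

(* [diamond_at e w al]: the component of degree e is a diamond, genuine when
   [al != 0] and otherwise fake of type 1, and [w] spans the component before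
   it. *)
Definition diamond_at e w (al : F) :=
  [/\ (q <= e)%N, w \in gcomp L e.-1,
    [/\ w ** x ** x = 0, w ** y ** y = 0, w ** y ** x = al *: (w ** x ** y)
      & w ** x ** y != 0],
    prechain e w & [\/ al = 0, w = v1 | prediamond w]].

Let ge7 : (7 <= q)%N := q7.

Let v1x : v1 ** x = U.
Proof. by rewrite -adxS; congr (X _ y); nlia. Qed.

Let v1xx : v1 ** x ** x = 0.
Proof. by rewrite v1x -adxS prednK ?(adxq (i := 1)) //; nlia. Qed.

Let v1yy : v1 ** y ** y = 0.
Proof. by case: (end_chain y_chain erefl _) => //; nlia. Qed.

Let om_mem : om \in gcomp L q.+1.
Proof.
apply: memy; first by nlia.
by rewrite [X in gcomp L X](_ : q = q.-1.+1) ?mem_u //; nlia.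
Qed.

(** The second diamond has al = -2, the very value that [gap_lower] leaves open; [second_gap] closes
    it. *)
Lemma om_chain : chain om y (q - 3).
Proof.
have [//|[t tq [ch ty]]] := chain_first om (q - 3); exfalso.
have ch' := ch; have ty' := ty; rewrite -v1x in ch' ty'.
have vt : X t (v1 ** x ** y) ** y \in gcomp L (q.+1 + t).+1.
  by rewrite v1x; apply: memy; [nlia|apply: mem_adx => //; nlia].
have v1yx' : v1 ** y ** x = - 2%:R *: (v1 ** x ** y) by rewrite v1x.
have [tE _] := @gap_lower v1 y (q - 2) _ v1xx v1yy v1yx' erefl y_chain
  (q.+1 + t).+1 t isT vt ch' ty' ltac:(nlia) ltac:(nlia).
by rewrite tE in ch ty; apply: second_gap.
Qed.

Lemma diamond_at_second : diamond_at q v1 (- 2%:R).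
Proof.
split=> //.
- by rewrite (_ : q.-1 = (q - 2).+1)%N ?mem_u //; nlia.
- by split=> //; rewrite v1x.
- by exists y, 1%N, (q - 2)%N; split; [by []|nlia|nlia|split=> //; exact: y_chain].
- by apply: Or32.
Qed.

Section Next.

Variables (e : nat) (w : L) (al : F).
Hypothesis De : diamond_at e w al.
Local Notation z := (w ** x ** y).

Let q_le_e : (q <= e)%N. Proof. by case: De. Qed.
Let wi : w \in gcomp L e.-1. Proof. by case: De. Qed.
Let wxx : w ** x ** x = 0. Proof. by case: De => ? ? []. Qed.
Let wyy : w ** y ** y = 0. Proof. by case: De => ? ? []. Qed.
Let wyx : w ** y ** x = al *: z. Proof. by case: De => ? ? []. Qed.
Let z0 : z != 0. Proof. by case: De => ? ? []. Qed.

Let wx_mem : w ** x \in gcomp L e.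
Proof. by rewrite [X in gcomp L X](_ : e = e.-1.+1) ?memx //; nlia. Qed.

Let wy_mem : w ** y \in gcomp L e.
Proof. by rewrite [X in gcomp L X](_ : e = e.-1.+1) ?memy //; nlia. Qed.

Let z_mem : z \in gcomp L e.+1.
Proof. by apply: memy => //; nlia. Qed.

(** The case al = -2 left by [gap_lower] is absurd for a fake diamond, and is excluded by [om_chain]
    for the second diamond and by [gap_previous] for a later one. *)
Lemma diamond_chain : chain z y (q - 3).
Proof.
have [//|[t tq [ch ty]]] := chain_first z (q - 3); exfalso.
have vt : X t z ** y \in gcomp L (e.+1 + t).+1.
  by apply: memy; [nlia|apply: mem_adx => //; nlia].
case: De => _ _ _ [g [j [K [j0 jK Kq [gj gw gch]]]]] last.
have [tE alE] := @gap_lower w g K al wxx wyy wyx gw gch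
  (e.+1 + t).+1 t isT vt ch ty ltac:(nlia) ltac:(nlia).
case: last => [al0|wE|].
- by move/eqP: alE; rewrite al0 eq_sym oppr_eq0 (negPf two_neq0).
- by move/eqP: ty; rewrite wE v1x om_chain //; nlia.
move=> [s [z1 [a [b [[sxx syy syx sxy] ab ch1 zw]]]]].
rewrite tE in ch ty; have wyx' := wyx; rewrite alE in wyx'.
apply: (@gap_previous w wxx wyx' e.-1 _ wi ch ty s z1 a b) => //; first by nlia.
exact: om_chain.
Qed.

Lemma diamond_zy : z ** y = 0.
Proof. by apply: (diamond_chain (k := 0)); nlia. Qed.

Lemma adxq_z : X q z = 0. Proof. exact: (adxq _ z_mem). Qed.

(** [z] is a multiple of [w y x], and [w y x^q] = 0. The gain of one power is what confines the
    longer distances to fake diamonds. *)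
Lemma genuine_adxq : al != 0 -> X q.-1 z = 0.
Proof.
move=> al0; apply: (scalerI al0); rewrite scaler0 -adxZ -wyx -adxSr prednK; last by nlia.
by apply: (adxq _ wy_mem); nlia.
Qed.

Lemma diamond_next : exists t,
  [/\ (q - 3 <= t < q)%N, chain z y t, X t z ** y != 0,
      (t = q.-1 -> al = 0)
    & diamond_at (e + t).+1 (X t.-1 z) 0 \/
      (t = (q - 3)%N \/ t = (q - 2)%N /\ al = 0) /\
      exists2 al', al' != 0 & diamond_at (e + t).+2 (X t z) al'].
Proof.
have [ch|[t tq [ch ty]]] := chain_first z q.
  by have := chain_neq0 _ z_mem z0 ch; rewrite adxq_z eqxx => /(_ isT).
have tq3 : (q - 3 <= t)%N.
  by rewrite leqNgt; apply/negP => tl; move/eqP: ty; apply; apply: diamond_chain.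
exists t; split=> //; first by rewrite tq3.
  move=> tE; apply/eqP; apply: contraLR ty => /genuine_adxq.
  by rewrite -tE => ->; rewrite br0l eqxx.
have v_mem : X t z \in gcomp L (e + t).+1 by rewrite -addSn mem_adx.
have [vyy vyxy vxyy] := end_chain ch erefl ltac:(nlia).
(* If x kills the end of the chain, the next diamond is fake and its [w] lies one step earlier. *)
have [vx|vx] := eqVneq (X t z ** x) 0.
  left; have tS : X t z = X t.-1 z ** x by rewrite -adxS prednK //; nlia.
  have vy0 : X t.-1 z ** y = 0 by apply: ch; nlia.
  split=> //.
  - by nlia.
  - by rewrite (_ : (e + t).+1.-1 = e.+1 + t.-1)%N ?mem_adx //; nlia.
  - by rewrite -tS vy0 !br0l scale0r.
  - exists z, e.+1, t.-1; split=> //; [by nlia|by nlia|split=> //].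
    by apply: chainW ch; nlia.
  by apply: Or31.
right.
have vy_mem : X t z ** y \in gcomp L (e + t).+2 by apply: memy.
have vyx0 : X t z ** y ** x != 0 by apply: (br_x_neq0 _ vy_mem).
have vyx_mem : X t z ** y ** x \in gcomp L (e + t).+3 by apply: memx.
have vyxx0 : X t z ** y ** x ** x != 0 by apply: (br_x_neq0 _ vyx_mem).
(* This uses t >= q-3: covering gives a scalar l with l [v y x x] = [z x^(t+3)] = 0. *)
have vxx : X t z ** x ** x = 0.
  have [l [m]] : exists s r : F, X t z ** x ** x
      = s *: (X t z ** y ** x) + r *: (X t z ** y ** y).
    by apply: (@cov (e + t).+2) => //; apply: memx => //; apply: memx.
  rewrite vyy scaler0 addr0 => E; rewrite E.
  suff -> : l = 0 by rewrite scale0r.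
  apply: (scale_zero vyxx0); rewrite -brZl -E -!adxS.
  by apply: (adx_eq0 _ adxq_z); nlia.
have vxy0 : X t z ** x ** y != 0.
  apply: contra_neq vx => vxy; apply: (@cov0 (e + t).+2) => //; exact: memx.
have [l vxyE] : exists l : F, X t z ** x ** y = l *: (X t z ** y ** x).
  have [l [m]] : exists s r : F, X t z ** x ** y
      = s *: (X t z ** y ** x) + r *: (X t z ** y ** y).
    by apply: (@cov (e + t).+2) => //; apply: memy => //; apply: memx.
  by rewrite vyy scaler0 addr0; exists l.
have l0 : l != 0 by apply: contra_neq vxy0 => l0; rewrite vxyE l0 scale0r.
(* [v x] is nonzero, whereas [z x^q] = 0 and, for al nonzero, [z x^(q-1)] = 0. *)
have tal : t = (q - 3)%N \/ t = (q - 2)%N /\ al = 0.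
  have tq1 : t <> q.-1.
    move=> tE; move/eqP: vx; apply; rewrite -adxS tE prednK ?adxq_z //; nlia.
  have [->|tq3'] := eqVneq t (q - 3)%N; first by left.
  right; have tE : t = (q - 2)%N by move/eqP: tq3'; nlia.
  split=> //; apply/eqP; apply: contraLR vx => /genuine_adxq.
  by rewrite -adxS tE (_ : q.-1 = (q - 2).+1)%N ?negbK => [->|] //; nlia.
split=> //; exists l^-1; first by rewrite invr_eq0.
split=> //.
- by nlia.
- by split=> //; rewrite vxyE scalerA mulVf ?scale1r.
- by exists z, e.+1, t; split=> //; nlia.
apply: Or33; case: tal => [tE|[tE al0]].
  exists w, z, al, 1; split=> //; first by split; rewrite ?scale1r.
  - by rewrite oner_eq0 orbT.
  - by rewrite -tE.
  - by rewrite -tE.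
(* The fake diamond is read one degree later, as type 0, which makes the chain q-3 steps long
   again. *)
exists (w ** x), (z ** x), 1, 0; split.
- split; rewrite ?wxx ?br0l ?scale1r ?scale0r //; exact: diamond_zy.
- by rewrite oner_eq0.
- move=> k kq; rewrite -adxSr; apply: ch; nlia.
by rewrite -adxSr; congr (X _ z); nlia.
Qed.

End Next.

(** * Spanning elements and dimensions of components *)

Definition spanned_by a i := forall u, u \in gcomp L i -> exists s : F, u = s *: a.

Lemma spanned_next i a : (0 < i)%N -> a \in gcomp L i -> a != 0 -> a ** y = 0 ->
  spanned_by (a ** x) i.+1.
Proof.
move=> i0 ai a0 ay u ui; have [s [t ->]] := cov i0 ai a0 ui.
by exists s; rewrite ay scaler0 addr0.
Qed.

Lemma spanned_chain i a k : (0 < i)%N -> (0 < k)%N -> a \in gcomp L i -> a != 0 ->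
  chain a y k -> spanned_by (X k a) (i + k).
Proof.
case: k => // k i0 _ ai a0 ch; rewrite addnS adxS.
apply: spanned_next; [nlia|exact: mem_adx| |exact: ch].
by apply: (chain_neq0 i0 ai) => //; apply: chainW ch.
Qed.

Lemma spanned_central i a : spanned_by a i -> a ** y = 0 ->
  centralizes y (gcomp L i).
Proof. by move=> sp ay u /sp[s ->]; rewrite brZl ay scaler0. Qed.

Lemma not_central i a : a \in gcomp L i -> a ** y != 0 ->
  ~ centralizes y (gcomp L i).
Proof. by move=> ai ay /(_ a ai)/eqP; apply/negP. Qed.

Lemma comp_lin i (s t : F) a b : (0 < i)%N -> a \in gcomp L i -> b \in gcomp L i ->
  s *: a + t *: b \in gcomp L i.
Proof.
move=> i0 ai bi; have [c0 cD] := gcomp_submod L i0.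
by apply: (cD) => //; rewrite -[t *: b]addr0; apply: (cD).
Qed.

Lemma basis1 i a : (0 < i)%N -> a \in gcomp L i -> a != 0 -> spanned_by a i ->
  is_basis (gcomp L i) [tuple a].
Proof.
move=> i0 ai a0 sp; split=> [u|c].
  split=> [/sp[s ->]|[c ->]].
    by exists (fun=> s); rewrite big_ord_recl big_ord0 addr0.
  rewrite big_ord_recl big_ord0 addr0 -[X in X \in _]addr0 -(scale0r a).
  exact: comp_lin.
rewrite big_ord_recl big_ord0 addr0 => /(scale_zero a0) c0 j.
by rewrite ord1.
Qed.

Lemma dim2 i a b : (0 < i)%N -> a \in gcomp L i -> b \in gcomp L i ->
  (forall u, u \in gcomp L i -> exists s t : F, u = s *: a + t *: b) ->
  (forall s t : F, s *: a + t *: b = 0 -> s = 0 /\ t = 0) ->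
  has_dim (gcomp L i) 2.
Proof.
move=> i0 ai bi sp ind; exists [tuple a; b]; split=> [u|c].
  split=> [/sp[s [t ->]]|[c ->]].
    exists (fun j : 'I_2 => if val j == 0%N then s else t).
    by rewrite !big_ord_recl big_ord0 addr0.
  by rewrite !big_ord_recl big_ord0 addr0; apply: comp_lin.
rewrite !big_ord_recl big_ord0 addr0 => /ind[c0 c1] j.
have [jE|jE] : j = ord0 \/ j = lift ord0 ord0.
  by case: j => [[|[|//]] jl]; [left|right]; apply: val_inj.
- by rewrite jE.
- by rewrite jE.
Qed.

Lemma spanned_not_dim2 i a : spanned_by a i -> has_dim (gcomp L i) 2 -> False.
Proof.
move=> sp [b [bs bi]].
have bj j : tnth b j \in gcomp L i.
  apply/bs; exists (fun l => (l == j)%:R); rewrite (bigD1 j) //= eqxx scale1r.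
  by rewrite big1 ?addr0 // => l /negPf ->; rewrite scale0r.
have [s sE] := sp _ (bj ord0); have [t tE] := sp _ (bj (lift ord0 ord0)).
have H1 : \sum_(l < 2) (if val l == 0%N then t else - s) *: tnth b l = 0.
  rewrite !big_ord_recl big_ord0 addr0 /= sE tE !scalerA mulrC mulNr.
  by rewrite -scalerDl subrr scale0r.
have /eqP := bi _ H1 (lift ord0 ord0); rewrite /= oppr_eq0 => /eqP s0.
have H2 : \sum_(l < 2) (if val l == 0%N then 1 else 0) *: tnth b l = 0.
  by rewrite !big_ord_recl big_ord0 addr0 /= sE s0 !scale0r scaler0 addr0.
by have /eqP := bi _ H2 ord0; rewrite /= oner_eq0.
Qed.

Lemma spanned_u k : (0 < k <= q - 2)%N -> spanned_by (X k y) k.+1.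
Proof.
move=> /andP[k0 kq]; rewrite -add1n; apply: spanned_chain => //.
by apply: chainW y_chain.
Qed.

Lemma low_central i : (2 <= i <= q - 2)%N -> centralizes y (gcomp L i).
Proof.
move=> iq; rewrite (_ : i = i.-1.+1); last by nlia.
by apply: (@spanned_central _ (X i.-1 y)); [apply: spanned_u|apply: uy]; nlia.
Qed.

(** * The components around a diamond *)

Section AtDiamond.

Variables (e : nat) (w : L) (al : F).
Hypothesis De : diamond_at e w al.
Local Notation z := (w ** x ** y).

Let q_le_e : (q <= e)%N. Proof. by case: De. Qed.
Let wi : w \in gcomp L e.-1. Proof. by case: De. Qed.
Let wxx : w ** x ** x = 0. Proof. by case: De => ? ? []. Qed.
Let wyy : w ** y ** y = 0. Proof. by case: De => ? ? []. Qed.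
Let wyx : w ** y ** x = al *: z. Proof. by case: De => ? ? []. Qed.
Let z0 : z != 0. Proof. by case: De => ? ? []. Qed.
Let wx_mem : w ** x \in gcomp L e.
Proof. by rewrite [X in gcomp L X](_ : e = e.-1.+1) ?memx //; nlia. Qed.
Let wy_mem : w ** y \in gcomp L e.
Proof. by rewrite [X in gcomp L X](_ : e = e.-1.+1) ?memy //; nlia. Qed.
Let wx0 : w ** x != 0. Proof. by apply: contra_neq z0 => ->; rewrite br0l. Qed.
Let w0 : w != 0. Proof. by apply: contra_neq wx0 => ->; rewrite br0l. Qed.

Lemma diamond_ge : (q <= e)%N. Proof. exact: q_le_e. Qed.

Lemma diamond_not_central : ~ centralizes y (gcomp L e).
Proof. exact: not_central wx_mem z0. Qed.

Lemma diamond_spanned_succ : spanned_by z e.+1.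
Proof.
move=> u ue; have [s [t ->]] := @cov e _ u ltac:(nlia) wx_mem wx0 ue.
by exists t; rewrite wxx scaler0 add0r.
Qed.

Lemma diamond_central_succ : centralizes y (gcomp L e.+1).
Proof. by apply: spanned_central diamond_spanned_succ _; apply: (diamond_zy De). Qed.

Lemma genuine_not_central_pred : al != 0 -> ~ centralizes y (gcomp L e.-1).
Proof.
move=> al0; apply: not_central wi _.
apply: contraNneq z0 => wy; have := wyx; rewrite wy br0l => /esym/eqP.
by rewrite scaler_eq0 (negPf al0).
Qed.

Lemma diamond_pred_chain : exists g j K,
  [/\ (0 < j)%N, (j + K = e.-1)%N, (q - 4 <= K)%N
    & [/\ g \in gcomp L j, g != 0, X K g = w & chain g y K]].
Proof.
case: De => _ _ _ [g [j [K [j0 jK Kq [gj gw gch]]]]] _.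
exists g, j, K; split=> //; split=> //.
by apply: contra_neq w0 => g0; rewrite -gw g0 adx00.
Qed.

Lemma diamond_spanned_pred : spanned_by w e.-1.
Proof.
have [g [j [K [j0 <- Kq [gj g0 <- gch]]]]] := diamond_pred_chain.
by apply: spanned_chain => //; nlia.
Qed.

Lemma fake_wy : al = 0 -> w ** y = 0.
Proof.
move=> al0; apply: (@cov0 e) => //; first by nlia.
by rewrite wyx al0 scale0r.
Qed.

Lemma fake_central_pred : al = 0 -> centralizes y (gcomp L e.-1).
Proof. by move/fake_wy; apply: spanned_central diamond_spanned_pred. Qed.

Lemma diamond_central_pred2 : centralizes y (gcomp L e.-2).
Proof.
have [g [j [K [j0 jK Kq [gj g0 _ gch]]]]] := diamond_pred_chain.
have -> : (e.-2 = j + K.-1)%N by nlia.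
apply: (@spanned_central _ (X K.-1 g)); last by apply: gch; nlia.
apply: spanned_chain => //; first by nlia.
by apply: chainW gch; nlia.
Qed.

Lemma diamond_basis_pred : is_basis (gcomp L e.-1) [tuple w].
Proof. by apply: basis1 => //; [nlia|apply: diamond_spanned_pred]. Qed.

Lemma fake_basis : al = 0 -> is_basis (gcomp L e) [tuple w ** x].
Proof.
move=> al0; apply: basis1 => //; first by nlia.
rewrite {1}(_ : e = e.-1.+1); last by nlia.
by apply: spanned_next => //; [nlia|apply: fake_wy].
Qed.

Lemma genuine_dim2 : al != 0 -> has_dim (gcomp L e) 2.
Proof.
move=> al0; apply: (@dim2 e (w ** x) (w ** y)) => //; first by nlia.
  move=> u ue; apply: (@cov e.-1) => //; first by nlia.
  by rewrite (_ : e.-1.+1 = e) //; nlia.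
move=> s t st.
have s0 : s = 0.
  apply: (scale_zero z0); have := congr1 (fun u => u ** y) st.
  by rewrite brDl !brZl wyy scaler0 addr0 br0l.
split=> //; apply: (mulIf al0); rewrite mul0r; apply: (scale_zero z0).
have := congr1 (fun u => u ** x) st.
by rewrite s0 scale0r add0r brZl br0l -scalerA -wyx.
Qed.

Lemma genuine_type : al != 0 -> exists mu : option F, diamond_of_type x y e mu.
Proof.
move=> al0.
have wB := diamond_basis_pred; have d2 := genuine_dim2 al0.
have [alE|alE] := eqVneq (1 + al) 0.
  exists None; split=> //; first by nlia.
  exists w; split=> //; rewrite wyx.
  by rewrite (_ : al = - 1) ?scaleN1r //; apply/eqP; rewrite -addr_eq0 addrC alE.
exists (Some (1 + al)^-1); split=> //; first by nlia.
exists w; split=> //; rewrite wyx scalerA; congr (_ *: _).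
by field.
Qed.

Lemma fake_types : al = 0 ->
  fake_diamond_of_type1 x y e /\ fake_diamond_of_type0 x y e.+1.
Proof.
move=> al0; split; split; try by nlia.
  by exists w; split=> //; [apply: diamond_basis_pred|apply: fake_wy].
exists (w ** x); split=> //; first exact: fake_basis.
exact: (diamond_zy De).
Qed.

(* The case [i = e'.-1] occurs only when [e'] is genuine. *)
Lemma next_diamond : exists e' w' al', [/\ diamond_at e' w' al',
  (e + (q - 2) <= e')%N,
  forall i, (e < i < e')%N -> centralizes y (gcomp L i) \/ i.+1 = e' /\ al' != 0
  & if al' == 0 then
      [\/ e' = e + (q - 2), e' = e + (q - 1) | e' = e + q /\ al = 0%R]%N
    else e' = (e + (q - 1))%N \/ e' = (e + q)%N /\ al = 0].
Proof.
have [t [/andP[t3 tq] ch ty tal]] := diamond_next De.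
have between i : (e < i <= e + t)%N -> centralizes y (gcomp L i).
  move=> /andP[ei it]; have -> : i = (e.+1 + (i - e.+1))%N by nlia.
  have [->|k0] := eqVneq (i - e.+1)%N 0%N.
    by rewrite addn0; apply: diamond_central_succ.
  apply: (@spanned_central _ (X (i - e.+1) z)); last by apply: ch; nlia.
  apply: spanned_chain => //; first by rewrite lt0n.
    by apply: memy => //; nlia.
  by apply: chainW ch; nlia.
case=> [D|[tE [al' al0 D]]].
  exists (e + t).+1, (X t.-1 z), 0; split=> //.
  - by nlia.
  - by move=> i ie; left; apply: between; nlia.
  rewrite eqxx.
  have [tE|[tE|tE]] : t = (q - 3)%N \/ t = (q - 2)%N \/ t = q.-1 by nlia.
  - by apply: Or31; nlia.
  - by apply: Or32; nlia.
  - by apply: Or33; split; [nlia|apply: tal].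
exists (e + t).+2, (X t z), al'; split=> //.
- by nlia.
- move=> i ie; have [it|it] := leqP i (e + t); first by left; apply: between; nlia.
  by right; split=> //; nlia.
rewrite (negPf al0); case: tE => [tE|[tE al0']]; first by left; nlia.
by right; split=> //; nlia.
Qed.

End AtDiamond.

(** Whether y centralizes the preceding component tells fake from genuine, independently of [w]. *)
Lemma genuine_same e w al w' al' :
  diamond_at e w al -> diamond_at e w' al' -> (al == 0) = (al' == 0).
Proof.
move=> D D'; have [a0|a0] := eqVneq al 0; have [a0'|a0'] := eqVneq al' 0 => //.
- by have := genuine_not_central_pred D' a0'; case; apply: (fake_central_pred D).
- by have := genuine_not_central_pred D a0; case; apply: (fake_central_pred D').
Qed.

Lemma covered i : (q <= i)%N -> exists e w al e' w' al',
  [/\ diamond_at e w al, diamond_at e' w' al', (e <= i < e')%N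
    & forall j, (e < j < e')%N ->
        centralizes y (gcomp L j) \/ j.+1 = e' /\ al' != 0].
Proof.
elim: i => [|i IHi] qi; first by nlia.
have [qi'|qi'] := leqP q i; last first.
  have [e' [w' [al' [D' le btw _]]]] := next_diamond diamond_at_second.
  exists q, v1, (- 2%:R), e', w', al'; split=> //; first exact: diamond_at_second.
  by nlia.
have [e [w [al [e' [w' [al' [D D' ie btw]]]]]]] := IHi qi'.
have [ie'|ie'] := ltnP i.+1 e'; first by exists e, w, al, e', w', al'; split=> //; nlia.
have [e'' [w'' [al'' [D'' le' btw' _]]]] := next_diamond D'.
by exists e', w', al', e'', w'', al''; split=> //; nlia.
Qed.

(** From L_q on, a component lies at a diamond or strictly between two successive ones; in between,
    only the component just before a genuine diamond escapes y. *)
Lemma not_central_cases i : (0 < i)%N -> ~ centralizes y (gcomp L i) ->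
  [\/ i = 1%N, exists w al, diamond_at i w al
    | exists w al, al != 0 /\ diamond_at i.+1 w al].
Proof.
move=> i0 nc; have [qi|iq] := leqP q i; last first.
  have [i1|i1] := leqP i 1; first by apply: Or31; nlia.
  have [iq2|iq2] := leqP i (q - 2); first by case: nc; apply: low_central; nlia.
  apply: Or33; exists v1, (- 2%:R); rewrite oppr_eq0 two_neq0; split=> //.
  by rewrite (_ : i.+1 = q) //; [exact: diamond_at_second|nlia].
have [e [w [al [e' [w' [al' [D D' /andP[ei ie] btw]]]]]]] := covered qi.
have [iE|iE] := eqVneq i e; first by apply: Or32; exists w, al; rewrite iE.
case: (btw i) => [|//|[iE' al0]]; first by nlia.
by apply: Or33; exists w', al'; rewrite iE'.
Qed.

Lemma no_three i : (0 < i)%N ->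
  ~ [/\ ~ centralizes y (gcomp L i), ~ centralizes y (gcomp L i.+1)
      & ~ centralizes y (gcomp L i.+2)].
Proof.
move=> i0 [n0 n1 n2]; case: (not_central_cases (i := i.+1) isT n1) => [||].
- by case: i i0 {n0 n1 n2}.
- by move=> [w [al /diamond_central_succ/n2]].
by move=> [w [al [_ /diamond_central_pred2/n0]]].
Qed.

Lemma two_genuine m : (1 < m)%N ->
  ~ centralizes y (gcomp L m.-1) -> ~ centralizes y (gcomp L m) ->
  has_dim (gcomp L m) 2 /\ exists mu : option F, diamond_of_type x y m mu.
Proof.
move=> m1 n0 n1; case: (not_central_cases (ltnW m1) n1) => [mE|[w [al D]]|].
- by rewrite mE in m1.
- have al0 : al != 0 by apply/eqP => /(fake_central_pred D)/n0.
  by split; [apply: genuine_dim2 D al0|apply: genuine_type D al0].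
by move=> [w [al [_ /diamond_central_pred2/n0]]].
Qed.

Lemma isolated_fake m : (2 < m)%N -> centralizes y (gcomp L m.-2) ->
  ~ centralizes y (gcomp L m.-1) -> centralizes y (gcomp L m) ->
  exists w, diamond_at m.-1 w 0.
Proof.
move=> m2 c0 n1 c2; case: (not_central_cases (i := m.-1) _ n1) => [||[w [al D]]|].
- by nlia.
- by nlia.
- have [al0|al0] := eqVneq al 0; first by exists w; rewrite -al0.
  by case: (genuine_not_central_pred D al0).
move=> [w [al [_ D]]]; case: (diamond_not_central D).
by rewrite prednK //; nlia.
Qed.

(** If y centralized the preceding component, the bracket of one of its nonzero elements with x
    would span L_m. *)
Lemma dim2_genuine m : (1 < m)%N -> has_dim (gcomp L m) 2 ->
  exists w al, al != 0 /\ diamond_at m w al.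
Proof.
move=> m1 d2; have mE : m = m.-1.+1 by nlia.
have n0 : ~ centralizes y (gcomp L m.-1).
  move=> c0; have [a am a0] := nonzero (i := m.-1) ltac:(nlia).
  apply: (@spanned_not_dim2 m (a ** x)) d2; rewrite {1}mE.
  by apply: spanned_next => //; [nlia|apply: c0].
case: (not_central_cases (i := m.-1) ltac:(nlia) n0) => [m2|[w [al D]]|].
- case: (@spanned_not_dim2 m (X 1 y)) => //; rewrite mE m2.
  by apply: spanned_u; nlia.
- case: (@spanned_not_dim2 m (w ** x ** y)) => //; rewrite mE.
  exact: diamond_spanned_succ D.
by rewrite -mE.
Qed.

(** The shift arises because [Fake] carries the degree as type 0 and [diamond_at] the degree as type
    1. *)
Definition diamond_of e (al : F) := if al == 0 then Fake e.+1 else Genuine e.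

Lemma diamond_of_diamond e w al : diamond_at e w al ->
  is_diamond y (diamond_of e al).
Proof.
move=> D; have := diamond_ge D; rewrite /diamond_of.
case: eqVneq => al0 eq /=.
  split; [nlia| | |]; first by apply: fake_central_pred D al0.
    exact: diamond_not_central D.
  exact: diamond_central_succ D.
by split; [nlia|apply: genuine_dim2 D al0].
Qed.

Lemma diamond_inv D : is_diamond y D -> D <> Genuine 1 ->
  exists e w al, diamond_at e w al /\ D = diamond_of e al.
Proof.
case: D => m /=.
  move=> [m0 d2] m1; have [|w [al [al0 D]]] := @dim2_genuine m _ d2.
    by have : m <> 1%N by [move=> E; case: m1; rewrite E]; nlia.
  by exists m, w, al; rewrite /diamond_of (negPf al0).
move=> [m2 c0 n1 c2] _; have [w D] := isolated_fake m2 c0 n1 c2.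
exists m.-1, w, 0; rewrite /diamond_of eqxx; split=> //; congr Fake; nlia.
Qed.

Lemma admissible_of e al d : admissible_degree (diamond_of e al) d <->
  d = e \/ d = e.+1 /\ al = 0.
Proof.
rewrite /diamond_of; case: eqVneq => al0 /=; first by split=> [[]|[|[]]]; auto.
by split=> [|[|[_ E]]]; auto; move: al0; rewrite E eqxx.
Qed.

Lemma earlier_of e al e' al' : (e.+1 < e')%N ->
  earlier (diamond_of e al) (diamond_of e' al').
Proof.
by move=> ee d d' /admissible_of de /admissible_of de'; nlia.
Qed.

Lemma earlier_lt e al e' al' :
  earlier (diamond_of e al) (diamond_of e' al') -> (e < e')%N.
Proof. by apply; apply/admissible_of; left. Qed.

Lemma consecutive_distance D D' : consecutive_diamonds y D D' ->
  exists d d', [/\ admissible_degree D d, admissible_degree D' d'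
    & d' = (d + (q - 1))%N].
Proof.
move=> [dD dD' lt none].
have D1' : D' <> Genuine 1.
  move=> E; move: lt; rewrite E; case: D dD {none} => m /=.
    by move=> [m0 _] lt; have := lt m 1%N erefl erefl; nlia.
  by move=> [m0 _ _ _] lt; have := lt m 1%N (or_intror erefl) erefl; nlia.
have [e' [w' [al' [De' D'E]]]] := diamond_inv dD' D1'; subst D'.
have g2 : - 2%:R != 0 :> F by rewrite oppr_eq0 two_neq0.
have [DE|D1] : D = Genuine 1 \/ D <> Genuine 1.
  by case: D {dD lt none} => [[|[|m]]|m]; [right|left|right|right].
- subst D; have e'q : e' = q.
    apply/eqP; rewrite eqn_leq (diamond_ge De') andbT leqNgt; apply/negP => qe.
    have := diamond_of_diamond diamond_at_second.
    rewrite /diamond_of (negPf g2) => dq; case: (none _ dq); split.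
      by move=> d d' /= -> ->; nlia.
    by move=> d d' /= -> /admissible_of; nlia.
  subst e'; exists 1%N, q; split=> //; last by nlia.
  by apply/admissible_of; left.
have [e [w [al [De DE]]]] := diamond_inv dD D1; subst D.
have ee' := earlier_lt lt.
have [e1 [w1 [al1 [De1 le1 btw deg]]]] := next_diamond De.
have e1E : e' = e1.
  apply/eqP; rewrite eqn_leq; apply/andP; split.
    rewrite leqNgt; apply/negP => e1e'.
    (* [earlier_of] asks for a gap of two, since a fake diamond occupies two degrees. *)
    have ne : e' <> e1.+1.
      move=> E; have := diamond_not_central De'; rewrite E; case.
      exact: diamond_central_succ De1.
    apply: (none _ (diamond_of_diamond De1)); split; apply: earlier_of; nlia.
  rewrite leqNgt; apply/negP => e'e1.
  case: (btw e'); [by nlia|exact: diamond_not_central De'|move=> [E _]].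
  by have := diamond_not_central De1; rewrite -E; case; apply: diamond_central_succ De'.
subst e1; move: deg; rewrite -(genuine_same De' De1).
(* A distance q-2 is corrected by reading the later diamond as type 0, a distance q by reading the
   earlier one as type 0. *)
case: eqVneq => al0'.
  case=> [E|E|[E al0]].
  - exists e, e'.+1; split; last by nlia.
      by apply/admissible_of; left.
    by apply/admissible_of; right.
  - exists e, e'; split; last by nlia.
      by apply/admissible_of; left.
    by apply/admissible_of; left.
  - exists e.+1, e'; split; last by nlia.
      by apply/admissible_of; right.
    by apply/admissible_of; left.
case=> [E|[E al0]].
- exists e, e'; split; last by nlia.
    by apply/admissible_of; left.
  by apply/admissible_of; left.
exists e.+1, e'; split; last by nlia.
  by apply/admissible_of; right.
by apply/admissible_of; left.
Qed.

End Diamonds.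
End Relations.

(** * Vanishing of the structure constants *)

Section TwoStepCentralizers.

Local Open Scope ring_scope.

Variables (F : fieldType) (p n q : nat) (c : nat -> F).
Hypothesis pF : p \in [pchar F].
Hypothesis p3 : (3 < p)%N.
Hypothesis qE : q = (p ^ n)%N.
Hypothesis q5 : (5 < q)%N.

(* Structure constants: [u_a u_b] = csum a b u_(a+b+1), where u_j = [y x^j] and
   [u_j y] = c j u_(j+1). *)
Definition csum a b := \sum_(k < b.+1) sbin F b k * c (a + k).

Hypothesis c0 : c 0 = 0.
Hypothesis c1 : c 1 = 0.
Hypothesis c_big : forall j, (q - 3 < j)%N -> c j = 0.
Hypothesis skew : forall a b, (a + b <= q - 3)%N -> csum a b = - csum b a.
Hypothesis jacobi : forall a b, (a + b <= q - 4)%N ->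
  csum a b * c (a + b).+1 = c a * csum a.+1 b + c b * csum a b.+1.
Hypothesis level3 : forall a b, (a + b = q - 3)%N ->
  csum a b = (-1) ^+ b * (c a - c b).
Hypothesis level2 : forall a b, (a + b = q - 2)%N -> (a <= q - 3)%N ->
  (b <= q - 3)%N ->
  csum a b = (-1) ^+ b * (c a * (1 + 2%:R * b%:R) - c b * (3%:R + 2%:R * b%:R)).

Let ge7 : (7 <= q)%N := q7 pF p3 qE q5.
Let two0 : 2%:R != 0 :> F := two_neq0 pF p3 qE q5.
Let q_odd' : odd q := q_odd pF p3 qE.

Let eq_opp0 (u : F) : u = - u -> u = 0.
Proof.
move=> /eqP; rewrite -subr_eq0 opprK -mulr2n -mulr_natl mulf_eq0 (negPf two0).
by move/eqP.
Qed.

Lemma csum_low1 a b : (forall k, (k < b)%N -> c (a + k) = 0) ->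
  csum a b.+1 = (-1) ^+ b * (b.+1%:R * c (a + b) - c (a + b.+1)).
Proof.
move=> lo; rewrite /csum !big_ord_recr /= big1 ?add0r => [|k _]; last first.
  by rewrite lo ?mulr0.
by rewrite sbinn /sbin binSn exprS; ring.
Qed.

Lemma csum_low a b : (forall k, (k < b)%N -> c (a + k) = 0) ->
  csum a b = (-1) ^+ b * c (a + b).
Proof.
move=> lo; rewrite /csum !big_ord_recr /= big1 ?add0r ?sbinn // => k _.
by rewrite lo ?mulr0.
Qed.

Lemma csum_high1 a b : (forall k, (2 <= k <= b)%N -> c (a + k) = 0) ->
  csum a b = c a - b%:R * c a.+1.
Proof.
move=> hi; rewrite /csum big_ord_recl sbin0 addn0 mul1r; congr (_ + _).
case: b hi => [|b] hi; first by rewrite big_ord0 mul0r oppr0.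
rewrite big_ord_recl /= big1 ?addr0 => [|k _].
  by rewrite /bump /= addn1 /sbin bin1; ring.
by rewrite /bump /= !add1n hi ?mulr0 //= !ltnS.
Qed.

Lemma csum_high a b : (forall k, (1 <= k <= b)%N -> c (a + k) = 0) -> csum a b = c a.
Proof.
move=> hi; rewrite csum_high1 => [|k kb]; last by apply: hi; lia.
case: b hi => [|b] hi; first by rewrite mul0r subr0.
by rewrite (_ : c a.+1 = 0) ?mulr0 ?subr0 // -addn1 hi.
Qed.

Let signodd b : odd b -> (-1) ^+ b = -1 :> F.
Proof. by move=> bo; rewrite -signr_odd bo expr1. Qed.

(** [level2] at (q-3, 1) says that this value equals -3 times itself. *)
Lemma c_last : c (q - 3) = 0.
Proof.
have := level2 (a := q - 3) (b := 1) ltac:(nlia) (leqnn _) ltac:(nlia).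
rewrite csum_high => [|[|[|k]] // _]; last by rewrite c_big //; nlia.
rewrite c1 => E; have : 2%:R * (2%:R * c (q - 3)) = 0.
  transitivity (c (q - 3) + 3%:R * c (q - 3)); first by ring.
  by rewrite {1}E; ring.
by move/eqP; rewrite !mulf_eq0 (negPf two0) => /eqP.
Qed.

Lemma c_three j : (j <= q - 5)%N ->
  2%:R * (c j * c j.+2) = c j.+1 * (c j + c j.+2).
Proof.
move=> jq; have := jacobi (a := j) (b := 1) ltac:(nlia).
rewrite c1 mul0r addr0 addn1 !csum_high1 => [|[|[|k]]|[|[|k]]] //.
move/eqP; rewrite -subr_eq0 => /eqP E; apply/eqP; rewrite -subr_eq0 -E.
by apply/eqP; ring.
Qed.

(** By [c_three], two adjacent nonzero values force the next to be nonzero, and so on up to the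
    index q-3, against [c_last]. *)
Lemma c_adjacent j : c j != 0 -> c j.+1 = 0.
Proof.
move=> cj; apply/eqP/negPn/negP => cj1.
have jq : (j <= q - 4)%N.
  by rewrite leqNgt; apply: contra cj1 => jq; rewrite c_big //; nlia.
have up m : (j + m <= q - 4)%N -> c (j + m) != 0 /\ c (j + m).+1 != 0.
  elim: m => [|m IHm] jm; first by rewrite addn0.
  have [|nz0 nz1] := IHm; first by nlia.
  rewrite addnS; split=> //; apply/eqP => E.
  have := c_three (j := j + m) ltac:(nlia); rewrite E !mulr0 addr0 => /esym/eqP.
  by rewrite mulf_eq0 (negPf nz0) (negPf nz1).
have [|_] := up (q - 4 - j)%N; first by nlia.
by rewrite subnKC // (_ : (q - 4).+1 = q - 3)%N ?c_last ?eqxx //; nlia.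
Qed.

Lemma c_adjacent2 j : c j != 0 -> c j.+2 = 0.
Proof.
move=> cj; have [jq|jq] := leqP j (q - 5); last by rewrite c_big //; nlia.
have := c_three jq; rewrite (c_adjacent cj) mul0r => /eqP.
by rewrite !mulf_eq0 (negPf two0) (negPf cj) => /eqP.
Qed.

Section Extremes.

Variables (i T : nat).
Hypothesis ci : c i != 0.
Hypothesis min_i : forall k, (k < i)%N -> c k = 0.
Hypothesis cT : c T != 0.
Hypothesis max_T : forall k, (T < k)%N -> c k = 0.

Let iT : (i <= T)%N.
Proof. by rewrite leqNgt; apply: contra ci => /max_T ->. Qed.

Let i2 : (2 <= i)%N.
Proof.
by case: i ci => [|[|//]]; rewrite ?c0 ?c1 eqxx.
Qed.

Let Tq : (T <= q - 4)%N.
Proof.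
have T3 : T <> (q - 3)%N by move=> E; move: cT; rewrite E c_last eqxx.
suff : (T <= q - 3)%N by nlia.
by rewrite leqNgt; apply: contra cT => /c_big ->.
Qed.

(** For even i take a = b = i/2 in [skew]: only the last term of [csum] reaches the index i. *)
Let i_odd : odd i.
Proof.
apply: contraT => ie; have iE : (i./2 + i./2 = i)%N.
  by rewrite addnn -[RHS]odd_double_half (negPf ie).
have := skew (a := i./2) (b := i./2) ltac:(nlia).
rewrite csum_low => [|k ki]; last by apply: min_i; nlia.
rewrite iE => /eq_opp0/eqP.
by rewrite mulf_eq0 signr_eq0 (negPf ci).
Qed.

(** At a = b = (i+1)/2 the last two terms reach i and i+1; as c (i+1) = 0, [skew] leaves ((i+1)/2) c
    i = 0. *)
Let i_mod : i.+1%:R = 0 :> F.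
Proof.
have iE : (i./2.+1 + i./2 = i)%N.
  by rewrite addSn addnn -[RHS]odd_double_half i_odd.
have := skew (a := i./2.+1) (b := i./2.+1) ltac:(nlia).
rewrite csum_low1 => [|k ki]; last by apply: min_i; nlia.
rewrite addnS iE (c_adjacent ci) subr0 => /eq_opp0/eqP.
rewrite !mulf_eq0 signr_eq0 (negPf ci) orbF /= => /eqP i0.
by rewrite (_ : i.+1 = 2 * i./2.+1)%N ?natrM ?i0 ?mulr0 //; nlia.
Qed.

(** Otherwise [jacobi] at (T, i) is in range and reduces to c i c T = 0. *)
Let i_ge : (q - 3 - T <= i)%N.
Proof.
rewrite leqNgt; apply: contra ci => iq; apply/eqP.
have := jacobi (a := T) (b := i) ltac:(nlia).
rewrite max_T ?mulr0; last by nlia.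
rewrite csum_high => [|k ki]; last by apply: max_T; nlia.
rewrite csum_high => [|k ki]; last by apply: max_T; nlia.
rewrite (max_T (ltnSn T)) mulr0 add0r => /esym/eqP.
by rewrite mulf_eq0 (negPf cT) orbF => /eqP.
Qed.

Let cT1 : c T.-1 = 0.
Proof.
apply/eqP; apply: contraT => /c_adjacent E; move: cT.
by rewrite (_ : T = T.-1.+1) ?E ?eqxx //; nlia.
Qed.

Let csum_T b : csum T b = c T.
Proof. by apply: csum_high => k kb; apply: max_T; nlia. Qed.

Let csum_T1 b : csum T.-1 b = - (b%:R * c T).
Proof.
rewrite csum_high1 => [|k kb]; last by apply: max_T; nlia.
by rewrite cT1 sub0r prednK //; nlia.
Qed.

Lemma extremes_false : False.
Proof.
have [To|Te] := boolP (odd T).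
  (* [level3] at (T, q-3-T) gives c (q-3-T) = 2 c T, hence i = q-3-T. Then [level2] at (T-1, i+2)
     reads -(i+2) c T = 0, where i+2 = 1 in F. *)
  have bo : odd (q - 3 - T) by rewrite oddB ?oddB ?q_odd' ?To //; nlia.
  have := level3 (a := T) (b := q - 3 - T) ltac:(nlia).
  rewrite csum_T signodd // => E.
  have cb : c (q - 3 - T) = 2%:R * c T.
    transitivity (-1 * (c T - c (q - 3 - T)) + c T); first by ring.
    by rewrite -E; ring.
  have iE : i = (q - 3 - T)%N.
    apply/eqP; rewrite eqn_leq i_ge andbT leqNgt; apply/negP => /min_i /eqP.
    by rewrite cb mulf_eq0 (negPf two0) (negPf cT).
  have := level2 (a := T.-1) (b := i.+2) ltac:(nlia) ltac:(nlia) ltac:(nlia).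
  rewrite csum_T1 cT1 (c_adjacent2 ci) !mul0r subr0 mulr0 => /eqP.
  by rewrite oppr_eq0 -natr1 i_mod add0r mul1r (negPf cT).
(* With b = q-2-T, [level3] at (T-1, b) gives c b = -b c T and [level2] at (T, b) gives (2+2b) c T =
   (3+2b) c b. Both i = b, where b = -1 in F, and i > b, where c b = 0, are contradictory. *)
have bo : odd (q - 2 - T) by rewrite oddB ?oddB ?q_odd' ?(negPf Te) //; nlia.
set b := (q - 2 - T)%N in bo *.
have := level2 (a := T) (b := b) ltac:(nlia) ltac:(nlia) ltac:(nlia).
rewrite csum_T signodd // mulN1r => E2.
have ib : (b <= i)%N.
  have : i <> b.-1 by move=> ib; move: i_odd bo; rewrite ib; case: (b) => //= k ->.
  by move: i_ge; rewrite /b; nlia.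
have := level3 (a := T.-1) (b := b) ltac:(nlia).
rewrite csum_T1 cT1 signodd // mulN1r sub0r opprK => E3.
have [iE|iN] := eqVneq i b.
  have bF : b%:R = -1 :> F by apply/eqP; rewrite -addr_eq0 natr1 -iE i_mod.
  move: ci; rewrite iE; apply/negP; rewrite negbK; apply/eqP.
  by move: E2; rewrite bF => /esym/eqP; rewrite -subr_eq0 => /eqP <-; ring.
have cb : c b = 0 by apply: min_i; nlia.
move: E3 E2; rewrite cb mul0r subr0 => /eqP; rewrite oppr_eq0 mulf_eq0 (negPf cT).
rewrite orbF => /eqP ->; rewrite mulr0 addr0 mulr1 => /eq_opp0 cT0.
by move: cT; rewrite cT0 eqxx.
Qed.

End Extremes.

Lemma all_c_eq0 j : c j = 0.
Proof.
apply/eqP; apply: contraT => cj.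
have ex : exists k, c k != 0 by exists j.
case: (ex_minnP ex) => i ci min_i.
have bnd k : c k != 0 -> (k <= q)%N.
  by move=> ck; rewrite leqNgt; apply: contra ck => kq; rewrite c_big //; nlia.
case: (ex_maxnP ex bnd) => T cT max_T.
case: (@extremes_false i T) => // k kl; apply/eqP; apply: contraT => ck.
  by have := min_i k ck; rewrite leqNgt kl.
by have := max_T k ck; rewrite leqNgt kl.
Qed.

End TwoStepCentralizers.

(** * Identities of the structure constants, from the Jacobi identity in low degree *)

Section Centralizing.

Local Open Scope ring_scope.

Variables (F : fieldType) (L : gradedLie F) (x y : L) (p n q : nat) (c : nat -> F).
Local Notation X := (adx x).
Local Notation om := (X q.-1 y ** y).
Local Notation v1 := (X (q - 2) y).
Hypothesis pF : p \in [pchar F].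
Hypothesis p3 : (3 < p)%N.
Hypothesis qE : q = (p ^ n)%N.
Hypothesis q5 : (5 < q)%N.
Hypothesis cE : forall j, (j <= q - 3)%N -> X j y ** y = c j *: X j.+1 y.
Hypothesis c_big : forall j, (q - 3 < j)%N -> c j = 0.
Hypothesis uq : X q y = 0.
Hypothesis yx_y : y ** x ** y = 0.
Hypothesis v1yy : v1 ** y ** y = 0.
Hypothesis v1yx : v1 ** y ** x = - 2%:R *: om.
Hypothesis om0 : om != 0.

Local Notation S := (csum c).

Let ge7 : (7 <= q)%N := q7 pF p3 qE q5.
Let two0 : 2%:R != 0 :> F := two_neq0 pF p3 qE q5.

Let u0 j : (j <= q.-1)%N -> X j y != 0.
Proof.
by move=> jq; apply: contra_neq om0 => /(adx_eq0 jq) ->; rewrite br0l.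
Qed.

Let c0 : c 0 = 0.
Proof.
apply: (@scale_zero _ _ (X 1 y)); first by apply: u0; nlia.
by rewrite -cE // bracket_alt.
Qed.

Let c1 : c 1 = 0.
Proof.
apply: (@scale_zero _ _ (X 2 y)); first by apply: u0; nlia.
by rewrite -cE ?yx_y //; nlia.
Qed.

Let u_u a b : (a + b <= q - 3)%N ->
  X a y ** X b y = S a b *: X (a + b).+1 y.
Proof.
move=> ab; rewrite (@leibniz _ _ _ _ _ _ b.+1) // scaler_suml.
apply: eq_bigr => k _; rewrite -adxD (addnC k) cE; last first.
  by have := ltn_ord k; nlia.
rewrite adxZ -adxD scalerA; congr (_ *: X _ y).
by have := ltn_ord k; nlia.
Qed.

(** The Leibniz term k = b is [v1 y] up to sign and stands apart; c (q-2) = 0 keeps it out of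
    [csum]. *)
Let u_u2 a b : (a + b = q - 2)%N ->
  X a y ** X b y = (-1) ^+ b *: (v1 ** y) + S a b *: X q.-1 y.
Proof.
move=> ab; rewrite (@leibniz _ _ _ _ _ _ b.+1) // /csum !big_ord_recr /=.
rewrite subnn adx0 -adxD (addnC b) ab sbinn c_big ?mulr0 ?addr0; last by nlia.
rewrite addrC; congr (_ + _); rewrite scaler_suml.
apply: eq_bigr => k _; rewrite -adxD (addnC k) cE; last first.
  by have := ltn_ord k; nlia.
rewrite adxZ -adxD scalerA; congr (_ *: X _ y).
by have := ltn_ord k; nlia.
Qed.

Let u_u1 a b : (a + b = q.-1)%N ->
  X a y ** X b y = ((-1) ^+ b * (1 + 2%:R * b%:R)) *: om.
Proof.
case: b => [|b] ab.
  by rewrite addn0 in ab; rewrite ab adx0 mulr0 addr0 mul1r scale1r.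
rewrite (@leibniz _ _ _ _ _ _ b.+2) // 2!big_ord_recr /= big1 ?add0r => [|k _].
  have -> : X b (X a y) = v1 by rewrite -adxD; congr (X _ y); nlia.
  have -> : v1 ** x = X q.-1 y by rewrite -adxS; congr (X _ y); nlia.
  rewrite subnn subSnn adxS !adx0 v1yx sbinn /sbin binSn scalerA -scalerDl.
  by congr (_ *: _); rewrite exprS; ring.
rewrite -adxD (addnC k) cE; last by have := ltn_ord k; nlia.
rewrite adxZ -adxD (_ : b.+1 - k + (a + k).+1 = q)%N ?uq ?scaler0 //.
by have := ltn_ord k; nlia.
Qed.

Let u_u_y a b : X a y ** X b y ** y
  = X a y ** y ** X b y + X a y ** (X b y ** y).
Proof. by rewrite brA addrCA subrr addr0. Qed.

Let skew a b : (a + b <= q - 3)%N -> S a b = - S b a.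
Proof.
move=> ab; apply: (@scale_inj _ _ (X (a + b).+1 y)); first by apply: u0; nlia.
by rewrite -u_u // brC u_u addnC // scaleNr.
Qed.

Let jacobi a b : (a + b <= q - 4)%N ->
  S a b * c (a + b).+1 = c a * S a.+1 b + c b * S a b.+1.
Proof.
move=> ab; apply: (@scale_inj _ _ (X (a + b).+2 y)); first by apply: u0; nlia.
have := u_u_y a b; rewrite u_u; last by nlia.
rewrite brZl !cE; [|nlia..].
rewrite brZl brZr !u_u; [|nlia..].
by rewrite addnS addSn !scalerA -scalerDl.
Qed.

Let level3 a b : (a + b = q - 3)%N -> S a b = (-1) ^+ b * (c a - c b).
Proof.
move=> ab; apply: (mulIf (_ : - 2%:R != 0)); first by rewrite oppr_eq0.
apply: (scale_inj om0).
(* Bracketing with x kills [y x^(q-1)] and turns [v1 y] into -2 [om], so that a single scalar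
   equation remains. *)
have := congr1 (fun u => u ** x) (u_u_y a b).
rewrite u_u; last by nlia.
rewrite (_ : (a + b).+1 = q - 2)%N; last by nlia.
rewrite (cE (j := a)) ?(cE (j := b)); [|nlia..].
rewrite !brZl brZr !u_u2; [|nlia..].
rewrite brDl !brZl !brDl !brZl -!adxS prednK ?uq ?scaler0 ?addr0; last by nlia.
rewrite v1yx !scalerA => ->; rewrite -scalerDl exprS; congr (_ *: _); ring.
Qed.

Let level2 a b : (a + b = q - 2)%N -> (a <= q - 3)%N -> (b <= q - 3)%N ->
  S a b = (-1) ^+ b * (c a * (1 + 2%:R * b%:R) - c b * (3%:R + 2%:R * b%:R)).
Proof.
move=> ab aq bq; apply: (scale_inj om0).
have := u_u_y a b.
rewrite u_u2 // (cE aq) (cE bq).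
rewrite brDl !brZl brZr v1yy scaler0 add0r !u_u1; [|nlia..].
rewrite !scalerA => ->; rewrite -scalerDl exprS -natr1; congr (_ *: _); ring.
Qed.

Lemma u_central j : (j < q - 2)%N -> X j y ** y = 0.
Proof.
move=> jq; rewrite cE; last by nlia.
by rewrite (all_c_eq0 pF p3 qE q5 c0 c1 c_big skew jacobi level3 level2) scale0r.
Qed.

End Centralizing.

(** Double negations replace the decidability of dimension over an arbitrary field. *)
Lemma finite_choice_dn (T : Type) (t0 : T) (P : nat -> T -> Prop) m :
  (forall j, (j < m)%N -> ~ ~ exists s, P j s) ->
  ~ ~ exists f, forall j, (j < m)%N -> P j (f j).
Proof.
elim: m => [|m IHm] H nf; first by apply: nf; exists (fun=> t0).
apply: IHm => [j jm|[f Hf]]; first by apply: H; apply: ltnW.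
apply: (H m) => // -[s Ps]; apply: nf.
exists (fun j => if j == m then s else f j) => j; rewrite ltnS leq_eqVlt.
by case: eqVneq => [-> //|_ /= /Hf].
Qed.

(** * Working hypotheses from the definition of a Nottingham algebra *)

Section Nottingham.

Local Open Scope ring_scope.

Variables (F : fieldType) (L : gradedLie F) (q : nat) (x y : L).
Hypothesis hL : nottingham L q.
Hypothesis hxy : standard_generators q x y.
Local Notation X := (adx x).
Local Notation om := (X q.-1 y ** y).
Local Notation v1 := (X (q - 2) y).

Lemma gens_mem : x \in gcomp L 1 /\ y \in gcomp L 1.
Proof.
have [[sp _] _ _ _ _] := hxy; split; apply/sp.
  exists (fun j : 'I_2 => if val j == 0%N then 1 else 0).
  by rewrite !big_ord_recl big_ord0 /= scale1r scale0r !addr0.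
exists (fun j : 'I_2 => if val j == 0%N then 0 else 1).
by rewrite !big_ord_recl big_ord0 /= scale1r scale0r add0r addr0.
Qed.

Lemma bracket_mem i a b : (0 < i)%N -> a \in gcomp L i -> b \in gcomp L 1 ->
  a ** b \in gcomp L i.+1.
Proof. by move=> i0 ai b1; rewrite -addn1; apply: gcomp_bracket. Qed.

Lemma gens_span u : u \in gcomp L 1 -> exists s t : F, u = s *: x + t *: y.
Proof.
have [[sp _] _ _ _ _] := hxy; move=> /sp[c ->].
by exists (c ord0), (c (lift ord0 ord0)); rewrite !big_ord_recl big_ord0 addr0.
Qed.

Lemma covering i a u : (0 < i)%N -> a \in gcomp L i -> a != 0 ->
  u \in gcomp L i.+1 -> exists s t : F, u = s *: (a ** x) + t *: (a ** y).
Proof.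
have [[_ _ _ cv _] _ _ _] := hL; move=> i0 ai a0 /(cv i a i0 ai a0)[b b1 ->].
by have [s [t ->]] := gens_span b1; exists s, t; rewrite brDr !brZr.
Qed.

Lemma nonzero_comp i : (0 < i)%N -> exists2 a, a \in gcomp L i & a != 0.
Proof. by have [[_ _ nz _ _] _ _ _] := hL; apply: nz. Qed.

Lemma covering0 i a : (0 < i)%N -> a \in gcomp L i -> a ** x = 0 -> a ** y = 0 ->
  a = 0.
Proof.
move=> i0 ai ax ay; apply/eqP; apply: contraT => a0.
have [u ui u0] := nonzero_comp (i := i.+1) isT.
have [s [t uE]] := covering i0 ai a0 ui.
by move: u0; rewrite uE ax ay !scaler0 addr0 eqxx.
Qed.

Lemma y_neq0 : y != 0.
Proof.
have [[_ li] _ _ _ _] := hxy; apply/eqP => y0.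
pose c := fun j : 'I_2 => if val j == 0%N then 0 else 1 : F.
have H : \sum_(j < 2) c j *: tnth [tuple x; y] j = 0.
  by rewrite !big_ord_recl big_ord0 /c /= scale0r scale1r y0 !addr0.
by have /eqP := li c H (lift ord0 ord0); rewrite /c /= oner_eq0.
Qed.

Lemma adx_q_eq0 p n i a : p \in [pchar F] -> q = (p ^ n)%N -> (5 < q)%N ->
  X q y = 0 -> (0 < i)%N -> a \in gcomp L i -> X q a = 0.
Proof.
move=> pF qE q5 uq; case: i => // i _; elim: i a => [|i IHi] a ai.
  have [s [t ->]] := gens_span ai; rewrite adxDr !adxZ uq scaler0 addr0.
  by rewrite (@adx_eq0 _ _ x 1 q x) ?scaler0 //; [lia|apply: bracket_alt].
have [z zi z0] := nonzero_comp (i := i.+1) isT.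
have [s [t ->]] := covering (i := i.+1) isT zi z0 ai.
rewrite adxDr !adxZ -adxSr adxS IHi // br0l scaler0 add0r.
have := @adx_ppow_der _ _ n _ x pF z y; rewrite -qE uq br0r (IHi z zi) br0l scaler0.
by rewrite addr0 => <-; rewrite scaler0.
Qed.

Lemma nottingham_data : exists p n,
  [/\ p \in [pchar F], (3 < p)%N, q = (p ^ n)%N & (5 < q)%N] /\
  [/\ forall j, (j < q - 2)%N -> X j y ** y = 0,
      forall i a, (0 < i)%N -> a \in gcomp L i -> X q a = 0,
      v1 ** y ** x = - 2%:R *: om & om != 0].
Proof.
have [_ [p pF [p3 [n qE]]] q5 [_ d2 nd2]] := hL.
have [_ cy v1b [v1xx v1yy] v1yx] := hxy; exists p, n; split=> //.
rewrite -/(adx x (q - 2) y) in v1b v1xx v1yy v1yx.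
have [x1 y1] := gens_mem.
have q0 := q7 pF p3 qE q5.
have v1x : v1 ** x = X q.-1 y by rewrite -adxS; congr (X _ y); lia.
have uq : X q y = 0 by rewrite -v1xx v1x -adxS prednK //; lia.
have umem k : X k y \in gcomp L k.+1.
  by elim: k => // k IHk; rewrite adxS; apply: bracket_mem.
have v1mem : v1 \in gcomp L q.-1.
  by rewrite (_ : q.-1 = (q - 2).+1) ?umem //; lia.
have v10 : v1 != 0.
  have [_ li] := v1b; apply/eqP => E.
  have H : \sum_(j < 1) (1 : F) *: tnth [tuple v1] j = 0.
    by rewrite big_ord_recl big_ord0 /= E scaler0 addr0.
  by have /eqP := li (fun=> 1) H ord0; rewrite oner_eq0.
have qS : (q.-1.+1 = q)%N by lia.
(* Otherwise [v1 y] alone would span the two-dimensional L_q. *)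
have v1x0 : v1 ** x != 0.
  apply/eqP => E; apply: (@spanned_not_dim2 _ _ q (v1 ** y)) d2 => u uq'.
  have [s [t ->]] := @covering q.-1 v1 u ltac:(lia) v1mem v10 ltac:(by rewrite qS).
  by exists t; rewrite E scaler0 add0r.
have om0 : om != 0.
  rewrite -v1x; apply: contra_neq v1x0 => E; apply: (@covering0 q) => //; first by lia.
  by rewrite -[X in gcomp L X]qS; apply: bracket_mem => //; lia.
have v1yx' : v1 ** y ** x = - 2%:R *: om by rewrite v1yx v1x scaleNr scaler_nat.
split=> //; last first.
  by move=> i a; apply: adx_q_eq0 pF qE q5 uq.
move=> j0 j0q; apply/eqP/negPn/negP => nz.
have u0 j : (j <= q - 2)%N -> X j y != 0.
  by move=> jq; apply: contra_neq v10; apply: adx_eq0.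
(* That L_(j+2) is not two-dimensional yields the scalars only up to double negation; this is
   enough, since the goal is now [False]. *)
apply: (@finite_choice_dn F 0 (fun j s => X j y ** y = s *: X j.+1 y) (q - 2)).
  move=> j jq nex; case: (nd2 j.+2); first by lia.
  apply: (@dim2 _ _ j.+2 (X j.+1 y) (X j y ** y)) => //.
  - by apply: bracket_mem.
  - by move=> u uj; apply: (covering _ (umem j) _ uj) => //; apply: u0; lia.
  move=> s t st; have [t0|t0] := eqVneq t 0.
    split=> //; move: st; rewrite t0 scale0r addr0.
    by apply: scale_zero; apply: u0; lia.
  case: nex; exists (- (t^-1 * s)); apply: (scalerI t0).
  rewrite scalerA mulrN mulrA divff // mul1r scaleNr.
  by apply/eqP; rewrite -addr_eq0 addrC st.
move=> [f fE]; move/negP: nz; apply; apply/eqP.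
pose c j := if (j < q - 2)%N then f j else 0.
apply: (@u_central _ _ x y p n q c) => //.
- by move=> j jq; rewrite /c ifT ?fE //; lia.
- by move=> j jq; rewrite /c ifF //; lia.
by apply: cy; apply: bracket_mem.
Qed.

End Nottingham.

Theorem theorem1 (F : fieldType) (L : gradedLie F) (q : nat) (x y : L)
    (hL : nottingham L q) (hxy : standard_generators q x y) :
  (* (a) *)
  (forall i, (0 < i)%N ->
     ~ [/\ ~ centralizes y (gcomp L i), ~ centralizes y (gcomp L i.+1)
         & ~ centralizes y (gcomp L i.+2)]) /\
  (* (b) *)
  (forall m, (1 < m)%N ->
     ~ centralizes y (gcomp L m.-1) -> ~ centralizes y (gcomp L m) ->
     has_dim (gcomp L m) 2 /\
     exists mu : option F, diamond_of_type x y m mu) /\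
  (* (c) *)
  (forall m, (2 < m)%N ->
     centralizes y (gcomp L m.-2) -> ~ centralizes y (gcomp L m.-1) ->
     centralizes y (gcomp L m) ->
     fake_diamond_of_type0 x y m /\ fake_diamond_of_type1 x y m.-1) /\
  (* (d) *)
  (forall D D', consecutive_diamonds y D D' ->
     exists d d', [/\ admissible_degree D d, admissible_degree D' d'
       & d' = (d + (q - 1))%N]).
Proof.
have [p [n [[pF p3 qE q5] [uy adxq v1yx om0]]]] := nottingham_data hL hxy.
have [x1 y1] := gens_mem hxy.
have cov0 := covering0 hL hxy.
have cov := covering hL hxy.
have nz := nonzero_comp hL.
have y0 := y_neq0 hxy.
have memx i a (i0 : (0 < i)%N) (ai : a \in gcomp L i) := bracket_mem i0 ai x1.
have memy i a (i0 : (0 < i)%N) (ai : a \in gcomp L i) := bracket_mem i0 ai y1.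
split; [|split; [|split]].
- exact: (no_three pF p3 qE q5 uy cov0 cov y1 memx memy adxq v1yx om0 y0).
- exact: (two_genuine pF p3 qE q5 uy cov0 cov y1 memx memy adxq v1yx om0 y0).
- move=> m m2 c0 n1 c2.
  have [w D] := isolated_fake pF p3 qE q5 uy cov0 cov y1 memx memy adxq v1yx om0
    y0 m2 c0 n1 c2.
  have [f1 f0] := fake_types pF p3 qE q5 uy cov0 cov y1 memx memy adxq v1yx D
    erefl.
  by split=> //; rewrite (_ : m = m.-1.+1) //; lia.
exact: (consecutive_distance pF p3 qE q5 uy cov0 cov y1 memx memy adxq v1yx om0
  y0 nz).
Qed.
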